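(* Let $(H,\langle\cdot,\cdot\rangle_H,\|\cdot\|_H)$ and $(U,\langle\cdot,\cdot\rangle_U,\|\cdot\|_U)$ be separable $\mathbb{R}$-Hilbert spaces, let $\mathbb{H}\subseteq H$ be a non-empty orthonormal basis of $H$, let $\mathfrak{v}\colon\mathbb{H}\to\mathbb{R}$ satisfy $\sup_{h\in\mathbb{H}}\mathfrak{v}_h<0$, let $A\colon D(A)\subseteq H\to H$ be the linear operator with $D(A)=\{v\in H\colon\sum_{h\in\mathbb{H}}|\mathfrak{v}_h\langle h,v\rangle_H|^2<\infty\}$ and $Av=\sum_{h\in\mathbb{H}}\mathfrak{v}_h\langle h,v\rangle_Hh$ for all $v\in D(A)$, and let $(H_r,\langle\cdot,\cdot\rangle_{H_r},\|\cdot\|_{H_r})$, $r\in\mathbb{R}$, be the family of interpolation spaces associated to $-A$. Let $\beta\in[0,\infty)$, $T\in(0,\infty)$, let $(\Omega,\mathcal{F},\mathbb{P},(\mathbb{F}_t)_{t\in[0,T]})$ be a filtered probability space which fulfills the usual conditions, let $(W_t)_{t\in[0,T]}$ be an $\mathrm{Id}_U$-cylindrical $(\mathbb{F}_t)_{t\in[0,T]}$-Wiener process, let $B\in\mathrm{HS}(U,H_\beta)$, and let $\mathbb{U}\subseteq U$ be an orthonormal basis of $U$. For $I\in\mathcal{P}(\mathbb{H})$, $J\in\mathcal{P}(\mathbb{U})$ let $P_I\colon H\to H$ and $\hat P_J\colon U\to U$ be the linear operators with $P_I(x)=\sum_{h\in I}\langle h,x\rangle_Hh$ and $\hat P_J(y)=\sum_{u\in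 J}\langle u,y\rangle_Uu$. For every $\theta\in\varpi_T$, $I\in\mathcal{P}_0(\mathbb{H})$, $J\in\mathcal{P}(\mathbb{U})$ let $\chi^{\theta,I,J}\colon[0,T]\times\Omega\to[0,1]$ be an $(\mathbb{F}_t)_{t\in[0,T]}$-adapted stochastic process and let $\mathbf{O}^{\theta,I,J}\colon[0,T]\times\Omega\to P_I(H)$ be a stochastic process which satisfies $\mathbf{O}^{\theta,I,J}_0=0$ and for every $t\in[0,T]$, $\mathbb{P}$-almost surely, $$\mathbf{O}^{\theta,I,J}_t=e^{(t-\llcorner t\lrcorner_\theta)A}\mathbf{O}^{\theta,I,J}_{\llcorner t\lrcorner_\theta}+\frac{\int_{\llcorner t\lrcorner_\theta}^t\chi^{\theta,I,J}_{\llcorner t\lrcorner_\theta}e^{(t-\llcorner t\lrcorner_\theta)A}P_IB\hat P_J\,dW_s}{1+\big\|\int_{\llcorner t\lrcorner_\theta}^tP_IB\hat P_J\,dW_s\big\|_H^2}.$$ Let $\varepsilon\in\Big[0,\frac{1}{(8[\max\{\|B\|_{\mathrm{HS}(U,H)},1\}]^2\max\{T,1\})^2}\Big)$. Then $$\sup_{\theta\in\varpi_T}\sup_{J\in\mathcal{P}(\mathbb{U})}\sup_{I\in\mathcal{P}_0(\mathbb{H})}\sup_{s\in[0,T]}\mathbb{E}\big[\exp\big(\varepsilon\|\mathbf{O}^{\theta,I,J}_s\|_H^2\big)\big]<\infty.$$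
   Context: $\mathcal{P}(X)$ is the power set of $X$ and $\mathcal{P}_0(X)$ the set of all finite subsets of $X$. $\varpi_T=\{\theta\in\mathcal{P}_0([0,T])\colon\{0,T\}\subseteq\theta\}$. For $\theta\in\varpi_T$: $\llcorner t\lrcorner_\theta=\max([0,t)\cap\theta)$ for $t>0$ and $\llcorner0\lrcorner_\theta=0$. Interpolation spaces: for $r\ge0$, $H_r=D((-A)^r)$ with $\|v\|_{H_r}=\|(-A)^rv\|_H$; for $r<0$, $H_r$ is the completion of $H$ with respect to $\|v\|_{H_r}=\|(-A)^rv\|_H$. $\mathrm{HS}$ denotes Hilbert-Schmidt operators. *)

(* Defs.v *)
From HB Require Import structures.
From mathcomp Require Import all_boot all_order all_algebra finmap.
From mathcomp Require Import all_classical all_reals all_analysis.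
From mathcomp Require summability.

Set Implicit Arguments.
Unset Strict Implicit.
Unset Printing Implicit Defensive.

Import Order.TTheory GRing.Theory Num.Theory.
Import numFieldNormedType.Exports.

Local Open Scope classical_set_scope.
Local Open Scope ring_scope.

(* A real Hilbert space is a complete normed module H together with a dot
   product ip : {dot H for idfun} inducing its norm. *)
Definition induces_norm (R : realType) (H : completeNormedModType R)
    (ip : {dot H for idfun}) : Prop :=
  forall x : H, `|x| ^+ 2 = ip x x.

Definition separable (X : topologicalType) : Prop :=
  exists D : set X, countable D /\ dense D.

Section hilbert.
Context (R : realType).
Implicit Types H U : completeNormedModType R.

(* The net of the partial sums, over the finite subsets A of H, of the family
   (f h)_(h in S). *)
Definition psum (H V : completeNormedModType R) (S : set H) (f : H -> V)
    (A : {fset H}) : V :=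
  summability.partial_sum (fun h => if h \in S then f h else 0) A.

Definition hsum (H V : completeNormedModType R) (S : set H) (f : H -> V) : V :=
  lim (psum S f @ summability.totally).

Definition orthonormal_basis H (ip : {dot H for idfun}) (E : set H) : Prop :=
  (forall h k, E h -> E k -> ip h k = (h == k)%:R) /\
  (forall x : H, psum E (fun h => ip h x *: h) @ summability.totally --> x).

(* P_I (and, on U, \hat P_J). *)
Definition basis_proj H (ip : {dot H for idfun}) (I : set H) (x : H) : H :=
  hsum I (fun h => ip h x *: h).

Definition diag_dom H (ip : {dot H for idfun}) (E : set H) (m : H -> R) :
    set H :=
  [set x | (\esum_(h in E) ((`|m h * ip h x| ^+ 2)%:E) < +oo)%E].

Definition diag_op H (ip : {dot H for idfun}) (E : set H) (m : H -> R)
    (x : H) : H :=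
  hsum E (fun h => (m h * ip h x) *: h).

(* Functional calculus of an operator A that is diagonal in the orthonormal
   basis E: the eigenvalue of A at h in E is <h, A h>, and f(A) is the diagonal
   operator with eigenvalues f(<h, A h>). *)
Definition eigval H (ip : {dot H for idfun}) (A : H -> H) (h : H) : R :=
  ip h (A h).

Definition semigroup H (ip : {dot H for idfun}) (E : set H) (A : H -> H)
    (t : R) : H -> H :=
  diag_op ip E (fun h => expR (t * eigval ip A h)).

(* H_r = D((-A)^r) with norm |(-A)^r v|, for r >= 0 only: for r < 0 the space
   H_r is a proper completion of H. *)
Definition interp_dom H (ip : {dot H for idfun}) (E : set H) (A : H -> H)
    (r : R) : set H :=
  diag_dom ip E (fun h => (- eigval ip A h) `^ r).

Definition interp_norm H (ip : {dot H for idfun}) (E : set H) (A : H -> H)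
    (r : R) (x : H) : R :=
  `|diag_op ip E (fun h => (- eigval ip A h) `^ r) x|.

(* B is a Hilbert-Schmidt operator from U, with orthonormal basis UU, to the
   Hilbert space with carrier D, a subspace of H, and norm N. Boundedness is
   required separately: square summability over one basis does not imply it. *)
Definition hilbert_schmidt U H (UU : set U) (D : set H) (N : H -> R)
    (B : U -> H) : Prop :=
  [/\ linear B,
      forall y, D (B y),
      exists C : R, forall y, N (B y) <= C * `|y| &
      (\esum_(u in UU) ((N (B u) ^+ 2)%:E) < +oo)%E].

(* The norm of HS(U, H); it does not depend on the orthonormal basis UU. *)
Definition hs_norm U H (UU : set U) (B : U -> H) : R :=
  Num.sqrt (fine (\esum_(u in UU) ((`|B u| ^+ 2)%:E))%E).

End hilbert.

Section stochastic.
Context (R : realType) (d : measure_display) (Omega : measurableType d).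
Context (P : probability Omega R).

(* G/B(V)-measurability, B(V) being the Borel sigma-algebra of V. *)
Definition measurable_wrt (V : topologicalType) (G : set_system Omega)
    (X : Omega -> V) : Prop :=
  forall S : set V, <<s @open V >> S -> G (X @^-1` S).

Definition sigma_gen (I : Type) (X : I -> Omega -> R) : set_system Omega :=
  <<s [set A | exists i (V : set R), open V /\ A = X i @^-1` V] >>.

Definition indep_sys (G1 G2 : set_system Omega) : Prop :=
  forall A B, G1 A -> G2 B -> P (A `&` B) = (P A * P B)%E.

(* A filtration indexed by [0, T] that fulfills the usual conditions:
   right-continuity, and the null events belong to F 0. *)
Record usual_filtration (T : R) (F : R -> set_system Omega) : Prop := {
  filtration_sigma : forall t : R, 0 <= t <= T -> sigma_algebra setT (F t);
  filtration_sub : forall t : R, 0 <= t <= T -> F t `<=` measurable;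
  filtration_le : forall s t : R, 0 <= s -> s <= t -> t <= T -> F s `<=` F t;
  filtration_right : forall t : R, 0 <= t < T ->
    F t = \bigcap_(s in `]t, T]) F s;
  filtration_null : forall A : set Omega, measurable A -> P A = 0%E -> F 0 A }.

(* Id_U-cylindrical F-Wiener process on [0, T]: W t u stands for <u, W_t>_U.
   Degenerate increments (u = 0) are left out of the Gaussian clause since
   normal_prob with zero standard deviation is not a Dirac measure. *)
Record cylindrical_wiener (U : completeNormedModType R) (T : R)
    (F : R -> set_system Omega) (W : R -> U -> Omega -> R) : Prop := {
  wiener_adapted : forall (t : R) (u : U), 0 <= t <= T ->
    measurable_wrt (F t) (W t u);
  wiener_start : forall u : U, {ae P, forall w, W 0 u w = 0};
  wiener_linear : forall (t a : R) (u v : U), 0 <= t <= T ->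
    {ae P, forall w, W t (a *: u + v) w = a * W t u w + W t v w};
  wiener_continuous : forall u : U,
    {ae P, forall w, {within `[0, T], continuous (fun t : R => W t u w)}};
  wiener_indep : forall s t : R, 0 <= s -> s < t -> t <= T ->
    indep_sys (F s) (sigma_gen (fun (u : U) w => W t u w - W s u w));
  wiener_gauss : forall (s t : R) (u : U), 0 <= s -> s < t -> t <= T ->
    u != 0 -> forall S : set R, measurable S ->
    P ((fun w => W t u w - W s u w) @^-1` S) =
    normal_prob 0 (Num.sqrt (t - s) * `|u|) S }.

Section integral.
Context (U H : completeNormedModType R) (UU : set U).
Context (F : R -> set_system Omega) (W : R -> U -> Omega -> R).

(* Y is a version of Psi (W_t - W_s), for Psi an F_s-measurable,
   square-integrable HS(U, H)-valued random variable. As W_t - W_s is not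
   U-valued, Psi (W_t - W_s) is the limit in L^2(P; H) of the net of the finite
   sums of the <u, W_t - W_s> Psi u over u in the orthonormal basis UU. *)
Definition is_increment_image (s t : R) (Psi : Omega -> U -> H)
    (Y : Omega -> H) : Prop :=
  [/\ forall w, hilbert_schmidt UU setT (fun x : H => `|x|) (Psi w),
      forall u, measurable_wrt (F s) (fun w => Psi w u),
      (\int[P]_w (\esum_(u in UU) ((`|Psi w u| ^+ 2)%:E)) < +oo)%E,
      measurable_wrt measurable Y &
      ((\int[P]_w (`|Y w - psum UU (fun u => (W t u w - W s u w) *: Psi w u) A|
                     ^+ 2)%:E)%E @[A --> summability.totally] --> 0%E)].

(* X is a version of the stochastic integral of Phi dW over (a, b], for Phi an
   elementary (step) process: Phi = Psi k on (p k, p k.+1] for a partition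
   a = p 0 <= ... <= p n = b and F_(p k)-measurable Psi k, in which case the
   integral is the sum of the Psi k (W_(p k.+1) - W_(p k)). *)
Definition is_stoch_integral (a b : R) (Phi : R -> Omega -> U -> H)
    (X : Omega -> H) : Prop :=
  exists (n : nat) (p : nat -> R) (Psi : nat -> Omega -> U -> H)
         (Y : nat -> Omega -> H),
  [/\ p 0%N = a /\ p n = b,
      forall k, (k < n)%N -> p k <= p k.+1,
      forall k (s : R), (k < n)%N -> p k < s <= p k.+1 -> Phi s = Psi k,
      forall k, (k < n)%N ->
        is_increment_image (p k) (p k.+1) (Psi k) (Y k) &
      measurable_wrt measurable X /\
      {ae P, forall w, X w = \sum_(k < n) Y k w}].

End integral.
End stochastic.

(* The time grids of \varpi_T. *)
Definition grid (R : realType) (T : R) : set (set R) :=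
  [set theta | [/\ finite_set theta, theta `<=` `[0, T], theta 0 & theta T]].

(* The largest element of [0, t) `&` theta; for theta in grid T and t > 0 this
   set is finite and nonempty, so that its supremum is its maximum. *)
Definition grid_floor (R : realType) (theta : set R) (t : R) : R :=
  if 0 < t then sup (`[0, t[ `&` theta) else 0.

(* Main.v *)
(* On a grid step of length tau put L = max(|B|_HS, 1)^2 and K = tau * L. In
   coordinates the step maps x to at most x + chi d / (1 + |d|^2), up to the
   contraction exp(tau A), where d is a Gaussian vector independent of (x, chi)
   whose covariance has trace at most K. Without taming, the Gaussian moment
   generating function of the cross term 2 eps chi <x, d> would give
     E exp(eps |x + chi d|^2) <= exp((eps + O(K) eps^2) |x|^2 + O(K));
   the taming factor 1 / (1 + |d|^2) = 1 - q perturbs the cross term only by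
   2 eps chi q <x, d>, which Young's inequality absorbs into eps^2 K |x|^2 and
   q^2 |d|^2 / K, and q <= min(1, |d|^2) keeps the exponential of the latter
   integrable with expectation 1 + O(K). As 1/rho + 20 K / rho^2 is at most
   1 / (rho - 20 K), induction over the grid bounds E exp(|O_t|^2 / rho) by
   exp(128 L t) whenever rho >= 44 L max(T, 1) + 20 L t, uniformly in the grid
   and in the projections.
   The driving noise exists only as an L^2-limit of finite sums over the basis
   of U; the one-step estimate is proved for these sums and passes to the limit
   by Fatou's lemma along an almost surely convergent subsequence. *)

Require Import Defs.
From HB Require Import structures.
From mathcomp Require Import all_boot all_order all_algebra finmap ring lra.
From mathcomp Require Import all_classical all_reals all_analysis.
From mathcomp Require Import measurable_realfun.
From mathcomp Require summability.
Import Order.TTheory GRing.Theory Num.Theory.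
Import numFieldNormedType.Exports.
Local Open Scope classical_set_scope.
Local Open Scope ring_scope.

Set Implicit Arguments.
Unset Strict Implicit.
Unset Printing Implicit Defensive.

(** * Convexity and growth of the exponential *)

Section exponential_inequalities.
Context {R : realType}.
Implicit Types (a b s x : R).

(** The step map on the parameter, [eps] to [eps + 20 K eps^2], is a discrete Riccati recursion. In
    [rho = 1 / eps] it turns into a shift by [20 K], and the shifts up to time [t] add up to
    [20 L t] on every grid. This is why the induction hypothesis ranges over all admissible [rho]
    and why no constant depends on the mesh. The cross term and the noise are separated pointwise by
    [expR_young], with a weight that equalizes the two resulting bounds. Only two Gaussian facts are
    then needed: the moment generating function of a linear form and [E exp(|d|^2 / (4 K)) <= 2].
    Both follow from a bound on the trace, so the dimension of P_I(H) disappears. Two obstacles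
    shape the rest. [O] is assumed measurable but not adapted, while the step needs the state at the
    last grid point to be independent of the next increment; adaptedness is therefore carried along
    by the same induction. And the two integrals in the recursion are separate versions, fixed only
    up to null sets, so they are compared coordinate by coordinate on [I]. *)

Lemma expR_young a b s : 0 < s ->
  expR (a + b) <= (s * expR (2 * a) + expR (2 * b) / s) / 2.
Proof.
move=> s0; rewrite expRD !(mulrC 2) !expRM_natr.
set x := expR a; set y := expR b.
rewrite ler_pdivlMr// -subr_ge0.
have -> : s * x ^+ 2 + y ^+ 2 / s - x * y * 2 = (s * x - y) ^+ 2 / s.
  by field; rewrite gt_eqF.
by rewrite divr_ge0 ?sqr_ge0// ltW.
Qed.

(* Each term lies above the tangent of expR at the weighted mean. *)
Lemma expR_jensen (I : Type) (r : seq I) (p z : I -> R) :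
  (forall i, 0 <= p i) -> \sum_(i <- r) p i <= 1 ->
  expR (\sum_(i <- r) p i * z i) <=
  (1 - \sum_(i <- r) p i) + \sum_(i <- r) p i * expR (z i).
Proof.
move=> p0 p1; set m := \sum_(i <- r) p i * z i.
have tan t : expR m * (1 + (t - m)) <= expR t.
  rewrite -{2}(subrK m t) expRD mulrC ler_wpM2r ?expR_ge0//.
  by rewrite expR_ge1Dx.
have : \sum_(i <- r) p i * (expR m * (1 + (z i - m))) <=
       \sum_(i <- r) p i * expR (z i).
  by apply: ler_sum => i _; rewrite ler_wpM2l.
have -> : \sum_(i <- r) p i * (expR m * (1 + (z i - m))) =
          expR m * ((\sum_(i <- r) p i) * (1 - m) + m).
  rewrite {3}/m mulr_suml -big_split/= mulr_sumr; apply: eq_bigr => i _.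
  by ring.
set q := \sum_(i <- r) p i => le.
rewrite -(lerD2l (1 - q)) in le; apply: le_trans le.
(* The missing weight [1 - q] sits at the point 0, where [expR] is 1. *)
have := tan 0; rewrite expR0.
have : 0 <= 1 - q by rewrite subr_ge0.
move: (expR m) => E; nra.
Qed.

Lemma sqr_le_expR a x : 0 < a -> 0 <= x -> x ^+ 2 <= 4 / a ^+ 2 * expR (a * x).
Proof.
move=> a0 x0; rewrite mulrAC ler_pdivlMr ?exprn_gt0//.
have e := @expR_ge1Dx R (a * x / 2).
have -> : expR (a * x) = expR (a * x / 2) ^+ 2.
  by rewrite -expRM_natr divfK.
have : 0 <= a * x by rewrite mulr_ge0// ltW.
move: e; set y := a * x; have -> : x ^+ 2 * a ^+ 2 = y ^+ 2 by rewrite /y; ring.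
move: (expR _) => E *; nra.
Qed.

End exponential_inequalities.

(** * Exponential integrals against the normal law *)

Section normal_distribution_integrals.
Context {R : realType}.
Local Notation mu := (@lebesgue_measure R).

(** The Radon-Nikodym derivative of [normal_prob] and [normal_pdf] integrate alike over every
    measurable set, so they agree almost everywhere. *)
Lemma ge0_integral_normal_prob (m s : R) (f : measurableTypeR R -> \bar R) :
  (forall x, 0 <= f x)%E -> measurable_fun setT f ->
  (\int[normal_prob m s]_x f x = \int[mu]_x (f x * (normal_pdf m s x)%:E))%E.
Proof.
move=> f0 mf; have dom := normal_prob_dominates m s.
rewrite -(Radon_Nikodym_SigmaFinite.change_of_variables dom)//.
apply: ge0_ae_eq_integral => //.
- apply: emeasurable_funM => //; apply: (measurable_int mu).
  exact: Radon_Nikodym_SigmaFinite.f_integrable.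
- apply: emeasurable_funM => //; apply/measurable_EFinP.
  exact: measurable_normal_pdf.
- by move=> x _; rewrite mule_ge0// Radon_Nikodym_SigmaFinite.f_ge0.
- by move=> x _; rewrite mule_ge0// lee_fin normal_pdf_ge0.
apply: ae_eqe_mul2l; apply: integral_ae_eq => //.
- exact: Radon_Nikodym_SigmaFinite.f_integrable.
- by apply/measurable_EFinP; exact: measurable_normal_pdf.
- by move=> E _ mE; rewrite -Radon_Nikodym_SigmaFinite.f_integral.
Qed.

(** Completing the square: the tilt by [expR (c * x)] moves the mean of the density from 0 to
    [c * s ^+ 2]. *)
Lemma integral_expR_normal_prob (s c : R) : s != 0 ->
  (\int[normal_prob 0 s]_x (expR (c * x))%:E = (expR (c ^+ 2 * s ^+ 2 / 2))%:E)%E.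
Proof.
move=> s0; rewrite ge0_integral_normal_prob//; last first.
  by apply/measurable_EFinP; apply: measurableT_comp.
transitivity (\int[mu]_x ((expR (c ^+ 2 * s ^+ 2 / 2))%:E *
                          (normal_pdf (c * s ^+ 2) s x)%:E))%E.
  apply: eq_integral => x _; rewrite -!EFinM !normal_pdfE// /normal_fun.
  congr EFin; rewrite mulrCA [RHS]mulrCA -!expRD; congr (_ * expR _).
  by field.
rewrite ge0_integralZl//; first by rewrite integral_normal_pdf mule1.
- by apply/measurable_EFinP; exact: measurable_normal_pdf.
- by move=> x _; rewrite lee_fin normal_pdf_ge0.
Qed.

(** The integrand halves the Gaussian exponent and leaves the density of standard deviation
    [Num.sqrt 2 * s]; the ratio of the peaks is [Num.sqrt 2]. *)
Lemma integral_expR_sqr_normal_prob (s : R) : s != 0 ->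
  (\int[normal_prob 0 s]_x (expR (x ^+ 2 / (4 * s ^+ 2)))%:E =
   (Num.sqrt 2)%:E)%E.
Proof.
move=> s0; rewrite ge0_integral_normal_prob//; last first.
  apply/measurable_EFinP; apply: measurableT_comp => //.
  by apply: measurable_funM => //; exact: measurable_funX.
have s2 : Num.sqrt 2 * s != 0 by rewrite mulf_neq0// gt_eqF// sqrtr_gt0.
transitivity (\int[mu]_x ((Num.sqrt 2)%:E *
                          (normal_pdf 0 (Num.sqrt 2 * s) x)%:E))%E.
  apply: eq_integral => x _; rewrite -!EFinM !normal_pdfE// /normal_fun.
  congr EFin; rewrite mulrCA -expRD [RHS]mulrA; congr (_ * expR _).
    rewrite /normal_peak exprMn sqr_sqrtr// -(mulrA 2) -(mulrnAr 2) (sqrtrM _ (ler0n _ 2)).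
    by rewrite invfM mulVKf// gt_eqF// sqrtr_gt0.
  by rewrite exprMn sqr_sqrtr//; field.
rewrite ge0_integralZl//; first by rewrite integral_normal_pdf mule1.
- by apply/measurable_EFinP; exact: measurable_normal_pdf.
- by move=> x _; rewrite lee_fin normal_pdf_ge0.
Qed.

End normal_distribution_integrals.

Section gaussian_variable.
Context {R : realType} {d : measure_display} {Omega : measurableType d}.
Context (P : probability Omega R).

Lemma integral_gaussian (X : Omega -> R) (s : R) (f : R -> R) :
  measurable_fun setT X ->
  (forall S : set R, measurable S -> P (X @^-1` S) = normal_prob 0 s S) ->
  measurable_fun setT f -> (forall x, 0 <= f x) ->
  (\int[P]_w (f (X w))%:E = \int[normal_prob 0 s]_x (f x)%:E)%E.
Proof.
move=> mX law mf f0.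
have mEf : measurable_fun [set: measurableTypeR R] (EFin \o f).
  exact/measurable_EFinP.
have mX' : measurable_fun [set: Omega] (X : Omega -> measurableTypeR R) by [].
rewrite -[LHS](ge0_integral_pushforward mX' _ measurableT mEf); last first.
  by move=> x _; rewrite /= lee_fin.
by apply: eq_measure_integral => S mS _; exact: law.
Qed.

Lemma gaussian_mgf (X : Omega -> R) (s c : R) : s != 0 ->
  measurable_fun setT X ->
  (forall S : set R, measurable S -> P (X @^-1` S) = normal_prob 0 s S) ->
  (\int[P]_w (expR (c * X w))%:E = (expR (c ^+ 2 * s ^+ 2 / 2))%:E)%E.
Proof.
move=> s0 mX law.
rewrite (@integral_gaussian X s (fun x => expR (c * x)))//.
- exact: integral_expR_normal_prob.
- by apply: measurableT_comp.
Qed.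

Lemma gaussian_expR_sqr (X : Omega -> R) (s : R) : s != 0 ->
  measurable_fun setT X ->
  (forall S : set R, measurable S -> P (X @^-1` S) = normal_prob 0 s S) ->
  (\int[P]_w (expR (X w ^+ 2 / (4 * s ^+ 2)))%:E = (Num.sqrt 2)%:E)%E.
Proof.
move=> s0 mX law.
rewrite (@integral_gaussian X s (fun x => expR (x ^+ 2 / (4 * s ^+ 2))))//.
- exact: integral_expR_sqr_normal_prob.
- apply: measurableT_comp => //; apply: measurable_funM => //.
Qed.

End gaussian_variable.

(** * The tamed step from a deterministic starting point *)

Section tamed_increment.
Context {R : realType} {I : Type}.
Implicit Types (r : seq I) (x d : I -> R).

Definition sumsq r x : R := \sum_(i <- r) x i ^+ 2.

Lemma sumsq_ge0 r x : 0 <= sumsq r x.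
Proof. by apply: sumr_ge0 => i _; exact: sqr_ge0. Qed.

(* The taming factor is chi (1 - q) with q = rho / (1 + rho); the part of the
   cross term carrying q is absorbed by Young's inequality. *)
Lemma tamed_increment_le r x d (eps chi K : R)
    (rho := sumsq r d) (q := rho / (1 + rho)) :
  0 < K -> 0 <= eps -> 0 <= chi <= 1 ->
  eps * sumsq r (fun i => x i + chi / (1 + rho) * d i) <=
  (eps + 16 * K * eps ^+ 2) * sumsq r x +
  2 * eps * chi * (\sum_(i <- r) x i * d i) +
  (q ^+ 2 / (16 * K) + eps) * rho.
Proof.
move=> K0 e0 /andP[c0 c1].
have rho0 : 0 <= rho by exact: sumsq_ge0.
have r1 : 0 < 1 + rho by rewrite ltr_wpDr.
have q0 : 0 <= q by rewrite divr_ge0// ltW.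
have q1 : q <= 1 by rewrite ler_pdivrMr// mul1r lerDr.
have -> : chi / (1 + rho) = chi * (1 - q).
  by rewrite /q; field; rewrite gt_eqF.
rewrite /rho /sumsq !mulr_sumr -!big_split/=.
apply: ler_sum => i _; move: (x i) (d i) => a b.
have a1 : (chi * (1 - q)) ^+ 2 <= 1.
  rewrite exprn_ile1// ?mulr_ge0 ?subr_ge0//.
  by rewrite mulr_ile1 ?subr_ge0// gerBl.
have b2 : eps * ((chi * (1 - q)) ^+ 2 * b ^+ 2) <= eps * b ^+ 2.
  by rewrite ler_wpM2l// ler_piMl ?sqr_ge0.
have young : - (2 * eps * chi * q * a * b) <=
    16 * K * eps ^+ 2 * a ^+ 2 + q ^+ 2 / (16 * K) * b ^+ 2.
  have c2 : chi ^+ 2 <= 1 by rewrite exprn_ile1.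
  have step : 16 * K * eps ^+ 2 * a ^+ 2 * chi ^+ 2 <= 16 * K * eps ^+ 2 * a ^+ 2.
    by rewrite ler_piMr// mulr_ge0 ?sqr_ge0// mulr_ge0 ?sqr_ge0// mulr_ge0// ltW.
  apply: (@le_trans _ _ (16 * K * eps ^+ 2 * a ^+ 2 * chi ^+ 2 +
                         q ^+ 2 / (16 * K) * b ^+ 2)); last exact: lerD.
  rewrite -subr_ge0.
  have -> : 16 * K * eps ^+ 2 * a ^+ 2 * chi ^+ 2 + q ^+ 2 / (16 * K) * b ^+ 2 -
    - (2 * eps * chi * q * a * b) =
    (16 * K * (eps * a * chi + q * b / (16 * K)) ^+ 2).
    by field; rewrite gt_eqF.
  by rewrite mulr_ge0 ?sqr_ge0// mulr_ge0// ltW.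
rewrite -subr_ge0; have := lerD b2 young; rewrite -subr_ge0.
move=> /le_trans; apply; rewrite le_eqVlt; apply/orP; left; apply/eqP; ring.
Qed.

(** With [y = rho / K], the bound [q <= 1] keeps the exponent [z] below [(1/8 + 1/22) y], hence
    strictly inside [y / 4], while [q ^+ 2 <= rho] extracts a factor [K] from [z]. Both uses of [q]
    meet in [expR z <= 1 + z * expR z]. *)
Lemma expR_tamed_noise_le (eps K rho : R) (q := rho / (1 + rho)) :
  0 < K -> 0 <= eps <= 44^-1 ->
  eps * K <= 44^-1 -> 0 <= rho ->
  expR (2 * ((q ^+ 2 / (16 * K) + eps) * rho)) <=
  1 + 128 * K * expR (rho / (4 * K)).
Proof.
move=> K0 /andP[e0 e1] eK rho0.
have r1 : 0 < 1 + rho by rewrite ltr_wpDr.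
have q0 : 0 <= q by rewrite divr_ge0// ltW.
have q1 : q <= 1 by rewrite ler_pdivrMr// mul1r lerDr.
have qr : q <= rho by rewrite ler_pdivrMr// ler_peMr// lerDl.
have [y yE y0] : exists2 y, rho = K * y & 0 <= y.
  by exists (rho / K); [rewrite mulrC divfK// gt_eqF|rewrite divr_ge0// ltW].
have -> : rho / (4 * K) = y / 4 by rewrite yE; field; rewrite gt_eqF.
set z := 2 * _.
have zE : z = q ^+ 2 * y / 8 + 2 * eps * K * y.
  by rewrite /z yE; field; rewrite gt_eqF.
have qq1 : q ^+ 2 <= 1 by rewrite exprn_ile1.
have qqy : q ^+ 2 <= K * y.
  by rewrite -yE (le_trans _ qr)// expr2 ler_piMr.
have z0 : 0 <= z.
  rewrite mulr_ge0// mulr_ge0// addr_ge0// divr_ge0 ?sqr_ge0// mulr_ge0//.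
  exact: ltW.
have zy : z <= (8^-1 + 22^-1) * y.
  rewrite zE.
  have : q ^+ 2 * y <= y by rewrite ler_piMl.
  have : eps * K * y <= 44^-1 * y by rewrite ler_wpM2r.
  lra.
have zK : z <= K * (y ^+ 2 / 8 + y / 22).
  rewrite zE.
  have : q ^+ 2 * y <= K * y ^+ 2 by rewrite (expr2 y) mulrA ler_wpM2r.
  have : eps * (K * y) <= 44^-1 * (K * y) by rewrite ler_wpM2r// mulr_ge0// ltW.
  lra.
have ez : expR z <= 1 + z * expR z.
  have := expR_ge1Dx (- z); have := expR_gt0 z.
  have : expR z * expR (- z) = 1 by rewrite -expRD subrr expR0.
  by move: (expR z) (expR (- z)) => u w; nra.
apply: (le_trans ez); rewrite lerD2l.
(* The slack left inside [y / 4] pays for the polynomial in [y]. It is at least 1/13, whence 13 and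
   [676 = 4 * 13 ^+ 2]; and [676 / 8 + 13 / 22 <= 128]. *)
pose al : R := 4^-1 - 8^-1 - 22^-1.
have al0 : 0 < al by rewrite /al; lra.
have s2 := sqr_le_expR al0 y0.
have s1 : al * y <= expR (al * y).
  by apply: le_trans (expR_ge1Dx _); rewrite lerDr.
have -> : y / 4 = al * y + (8^-1 + 22^-1) * y by rewrite /al; lra.
rewrite expRD mulrA.
apply: ler_pM => //; last by rewrite ler_expR.
apply: (le_trans zK); rewrite (mulrC _ K) -(mulrA K) ler_wpM2l ?(ltW K0)//.
move: s1 s2; move: (expR _) => E s1 s2.
have [alV al2] : al^-1 <= 13 /\ 4 / al ^+ 2 <= 676.
  have al13 : 13^-1 <= al by rewrite /al; lra.
  have alV : al^-1 <= 13 by rewrite -[leRHS]invrK lef_pV2 ?posrE ?invr_gt0.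
  split=> //; rewrite -exprVn (_ : 676 = 4 * 13 ^+ 2); last by ring.
  by rewrite ler_wpM2l// lerXn2r ?nnegrE ?invr_ge0// ltW.
have E0 : 0 <= E by rewrite (le_trans _ s1)// mulr_ge0// ltW.
have : y <= 13 * E.
  apply: (@le_trans _ _ (al^-1 * E)); first by rewrite ler_pdivlMl.
  by rewrite ler_wpM2r.
have : y ^+ 2 <= 676 * E by apply: (le_trans s2); rewrite ler_wpM2r.
lra.
Qed.

End tamed_increment.

Section tamed_increment_expectation.
Context {R : realType} {d : measure_display} {Omega : measurableType d}.
Context (P : probability Omega R) (I : Type).

Lemma measurable_sumsq d' (T : measurableType d') (r : seq I) (X : I -> T -> R) :
  (forall i, measurable_fun setT (X i)) ->
  measurable_fun setT (fun w => sumsq r (X^~ w)).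
Proof.
by move=> mX; apply: measurable_sum => i; exact: measurable_funX.
Qed.

Lemma measurable_inv_sumsq d' (T : measurableType d') (r : seq I)
    (X : I -> T -> R) :
  (forall i, measurable_fun setT (X i)) ->
  measurable_fun setT (fun w => (1 + sumsq r (X^~ w))^-1).
Proof.
move=> mX; have m : measurable_fun setT (fun w => 1 + sumsq r (X^~ w)).
  by apply: measurable_funD => //; exact: measurable_sumsq.
have := measurableT_comp (measurable_powR (-1)) m.
congr measurable_fun; apply/funext => w /=.
by rewrite powR_inv1// addr_ge0// sumsq_ge0.
Qed.

Lemma tamed_increment_expectation (r : seq I) (X : I -> Omega -> R) (x : I -> R)
    (eps chi K : R) :
  0 < K -> 0 <= eps <= 44^-1 -> eps * K <= 44^-1 -> 0 <= chi <= 1 ->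
  (forall i, measurable_fun setT (X i)) ->
  (forall l : I -> R,
    (\int[P]_w (expR (\sum_(i <- r) l i * X i w))%:E <=
     (expR (K * sumsq r l / 2))%:E)%E) ->
  (\int[P]_w (expR (sumsq r (X^~ w) / (4 * K)))%:E <= 2%:E)%E ->
  (\int[P]_w (expR (eps * sumsq r (fun i =>
      x i + chi / (1 + sumsq r (X^~ w)) * X i w)))%:E <=
   (expR ((eps + 20 * K * eps ^+ 2) * sumsq r x + 128 * K))%:E)%E.
Proof.
move=> K0 /andP[e0 e1] eK /andP[c0 c1] mX mgf sq2.
(* The factor 4 is the 2 of the cross term, doubled by [expR_young]. *)
set l := fun i => 4 * eps * chi * x i.
(* With this weight the bounds [expR (8 K eps^2 |x|^2)] of the cross term and
   [1 + 256 K <= expR (256 K)] of the noise meet at their geometric mean, named [E] below. Its part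
   [4 K eps^2], added to the 16 of [C], makes 20. *)
set s := expR (128 * K - 4 * K * eps ^+ 2 * sumsq r x).
have s0 : 0 < s by exact: expR_gt0.
set C := expR ((eps + 16 * K * eps ^+ 2) * sumsq r x).
set f1 := fun w => expR (\sum_(i <- r) l i * X i w).
set f2 := fun w => expR (sumsq r (X^~ w) / (4 * K)).
have pw w : expR (eps * sumsq r (fun i =>
      x i + chi / (1 + sumsq r (X^~ w)) * X i w)) <=
    C * s / 2 * f1 w + (C / s / 2 + C / s / 2 * (128 * K) * f2 w).
  have c01 : 0 <= chi <= 1 by rewrite c0.
  have le := tamed_increment_le r x (X^~ w) K0 e0 c01.
  rewrite -ler_expR in le; apply: (le_trans le).
  have -> : C * s / 2 * f1 w + (C / s / 2 + C / s / 2 * (128 * K) * f2 w) =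
            C * ((s * f1 w + (1 + 128 * K * f2 w) / s) / 2).
    by field; rewrite gt_eqF.
  rewrite -addrA expRD -/C ler_wpM2l ?expR_ge0//.
  apply: (le_trans (expR_young _ _ s0)).
  have e01 : 0 <= eps <= 44^-1 by rewrite e0.
  have := expR_tamed_noise_le K0 e01 eK (sumsq_ge0 r (X^~ w)).
  rewrite -/(f2 w).
  have -> : expR (2 * (2 * eps * chi * \sum_(i <- r) x i * X i w)) = f1 w.
    rewrite /f1 !mulr_sumr; congr expR; apply: eq_bigr => i _.
    by rewrite /l; ring.
  set N := expR _ => leN.
  by rewrite ler_wpM2r// lerD2l ler_wpM2r// invr_ge0 ltW.
have C0 : 0 <= C by exact: expR_ge0.
have a0 : 0 <= C * s / 2 by rewrite divr_ge0// mulr_ge0// ltW.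
have b0 : 0 <= C / s / 2 by rewrite !divr_ge0// ltW.
have bK0 : 0 <= C / s / 2 * (128 * K) by rewrite mulr_ge0// mulr_ge0// ltW.
have msum (g : I -> R) : measurable_fun setT (fun w => \sum_(i <- r) g i * X i w).
  by apply: measurable_sum => i; exact: measurable_funM.
have mf1 : measurable_fun setT f1 by exact: measurableT_comp.
have mf2 : measurable_fun setT f2.
  by apply: measurableT_comp => //; apply: measurable_funM => //; exact: measurable_sumsq.
have f1_ge0 w : 0 <= f1 w by exact: expR_ge0.
have f2_ge0 w : 0 <= f2 w by exact: expR_ge0.
apply: (@le_trans _ _ (\int[P]_w ((C * s / 2 * f1 w)%:E +
   ((C / s / 2)%:E + (C / s / 2 * (128 * K) * f2 w)%:E)))%E).
  apply: ge0_le_integral => //.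
  - apply/measurable_EFinP; apply: measurableT_comp => //.
    apply: measurable_funM => //; apply: measurable_sumsq => i.
    apply: measurable_funD => //; apply: measurable_funM => //.
    by apply: measurable_funM => //; exact: measurable_inv_sumsq.
  - apply/measurable_EFinP; apply: measurable_funD; first exact: measurable_funM.
    by apply: measurable_funD => //; exact: measurable_funM.
  - by move=> w _; rewrite -!EFinD lee_fin.
rewrite ge0_integralD//; last 4 first.
- by move=> w _; rewrite lee_fin mulr_ge0.
- by apply/measurable_EFinP; exact: measurable_funM.
- by move=> w _; rewrite -EFinD lee_fin addr_ge0// mulr_ge0.
- by apply/measurable_EFinP; apply: measurable_funD => //; exact: measurable_funM.
rewrite ge0_integralD//; last 2 first.
- by move=> w _; rewrite lee_fin mulr_ge0.
- by apply/measurable_EFinP; exact: measurable_funM.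
under eq_integral do rewrite EFinM.
under [X in (_ + (_ + X) <= _)%E]eq_integral do rewrite EFinM.
rewrite !ge0_integralZl//; last 4 first.
- by apply/measurable_EFinP.
- by move=> w _; rewrite lee_fin.
- by apply/measurable_EFinP.
- by move=> w _; rewrite lee_fin.
rewrite integral_cst//= probability_setT.
set S := sumsq r x; have S0 : 0 <= S by exact: sumsq_ge0.
have i1 : (\int[P]_w (f1 w)%:E <= (expR (8 * K * eps ^+ 2 * S))%:E)%E.
  apply: (le_trans (mgf l)); rewrite lee_fin ler_expR.
  have -> : K * sumsq r l / 2 = 8 * K * eps ^+ 2 * S * chi ^+ 2.
    rewrite /S /sumsq !(mulr_sumr, mulr_suml); apply: eq_bigr => i _.
    by rewrite /l; field.
  rewrite ler_piMr ?exprn_ile1// mulr_ge0// mulr_ge0 ?sqr_ge0// mulr_ge0//.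
  exact: ltW.
apply: (@le_trans _ _ ((C * s / 2)%:E * (expR (8 * K * eps ^+ 2 * S))%:E +
  ((C / s / 2)%:E * 1 + (C / s / 2 * (128 * K))%:E * 2%:E))%E).
  apply: leeD; first by rewrite lee_wpmul2l// lee_fin.
  by rewrite leeD2l// lee_wpmul2l// lee_fin.
rewrite -!EFinM -!EFinD lee_fin.
pose E := expR (128 * K + 4 * K * eps ^+ 2 * S).
have e2 : s * expR (8 * K * eps ^+ 2 * S) = E.
  by rewrite /s -expRD; congr expR; rewrite -/S; ring.
have e3 : expR (256 * K) / s = E.
  by rewrite /s -expRN -expRD; congr expR; rewrite -/S; ring.
have -> : expR ((eps + 20 * K * eps ^+ 2) * S + 128 * K) = C * E.
  by rewrite -expRD; congr expR; rewrite -/S; ring.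
have : (1 + 256 * K) / s <= E.
  by rewrite -e3 ler_wpM2r ?invr_ge0 ?(ltW s0)// expR_ge1Dx.
move: e2 => /(congr1 ( *%R^~ C)) e2 /(ler_wpM2l C0).
have -> : C * s / 2 * expR (8 * K * eps ^+ 2 * S) +
    (C / s / 2 * 1 + C / s / 2 * (128 * K) * 2) =
  (s * expR (8 * K * eps ^+ 2 * S) * C + C * ((1 + 256 * K) / s)) / 2.
  by field; rewrite gt_eqF.
by rewrite e2; lra.
Qed.

End tamed_increment_expectation.

(** * Exponential square moments under a trace bound *)

Section gaussian_vector.
Context {R : realType} {d : measure_display} {Omega : measurableType d}.
Context (P : probability Omega R) (I : Type).

(* Where q i = 0 the junk value x / 0 = 0 makes the third hypothesis harmless. *)
Lemma expectation_expR_sumsq_le2 (r : seq I) (X : I -> Omega -> R) (q : I -> R)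
    (K : R) :
  0 < K -> (forall i, 0 <= q i) -> \sum_(i <- r) q i <= K ->
  (forall i, measurable_fun setT (X i)) ->
  (forall i, (\int[P]_w (expR (X i w ^+ 2 / (4 * q i)))%:E <= 2%:E)%E) ->
  (forall i w, q i = 0 -> X i w = 0) ->
  (\int[P]_w (expR (sumsq r (X^~ w) / (4 * K)))%:E <= 2%:E)%E.
Proof.
move=> K0 q0 qK mX sq2 X0.
(* These weights turn the exponent into a subconvex combination of one-dimensional ones; Jensen's
   inequality then works for arbitrary correlations between the coordinates. *)
pose p i := q i / K.
have p0 i : 0 <= p i by rewrite divr_ge0// ltW.
have p1 : \sum_(i <- r) p i <= 1 by rewrite -mulr_suml ler_pdivrMr// mul1r.
have mE i : measurable_fun setT (fun w => expR (X i w ^+ 2 / (4 * q i))).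
  apply: measurableT_comp => //; apply: measurable_funM => //.
  exact: measurable_funX.
have pw w : expR (sumsq r (X^~ w) / (4 * K)) <= (1 - \sum_(i <- r) p i) +
    \sum_(i <- r) p i * expR (X i w ^+ 2 / (4 * q i)).
  apply: le_trans (expR_jensen (fun i => X i w ^+ 2 / (4 * q i)) p0 p1).
  rewrite ler_expR /sumsq mulr_suml ler_sum// => i _; rewrite /p.
  have [qi0|qi0] := eqVneq (q i) 0.
    by rewrite (X0 _ _ qi0) qi0 expr0n/= !mul0r.
  by rewrite le_eqVlt; apply/orP; left; apply/eqP; field; rewrite qi0 gt_eqF.
apply: (@le_trans _ _ (\int[P]_w ((1 - \sum_(i <- r) p i)%:E +
   \sum_(i <- r) (p i * expR (X i w ^+ 2 / (4 * q i)))%:E))%E).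
  apply: ge0_le_integral => //.
  - apply/measurable_EFinP; apply: measurableT_comp => //.
    by apply: measurable_funM => //; exact: measurable_sumsq.
  - apply: emeasurable_funD => //; apply: emeasurable_sum => i.
    by apply/measurable_EFinP; exact: measurable_funM.
  - by move=> w _; rewrite sumEFin -EFinD lee_fin.
have sum0 w : (0 <= \sum_(i <- r) (p i * expR (X i w ^+ 2 / (4 * q i)))%:E)%E.
  by apply: sume_ge0 => i _; rewrite lee_fin mulr_ge0// expR_ge0.
rewrite ge0_integralD//; last 2 first.
- by move=> w _; rewrite lee_fin subr_ge0.
- apply: emeasurable_sum => i.
  by apply/measurable_EFinP; exact: measurable_funM.
rewrite integral_cst//= probability_setT mule1.
rewrite ge0_integral_sum//; last 2 first.
- by move=> i; apply/measurable_EFinP; exact: measurable_funM.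
- by move=> i w _; rewrite lee_fin mulr_ge0// expR_ge0.
apply: (@le_trans _ _ ((1 - \sum_(i <- r) p i)%:E + \sum_(i <- r) (p i * 2)%:E)%E).
  rewrite leeD2l// lee_sum// => i _.
  under eq_integral do rewrite EFinM.
  rewrite ge0_integralZl//; [|exact/measurable_EFinP|by rewrite lee_fin].
  by rewrite (EFinM (p i) 2) lee_wpmul2l ?lee_fin.
have -> : \sum_(i <- r) (p i * 2)%:E = ((\sum_(i <- r) p i) * 2)%:E.
  by rewrite mulr_suml sumEFin.
by rewrite -EFinD lee_fin; lra.
Qed.

End gaussian_vector.

(** * Independence and almost sure limits *)

Section sub_sigma_algebras.
Context {R : realType} {d : measure_display} {Omega : measurableType d}.
Context (P : probability Omega R).
Implicit Types F G : set_system Omega.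

Lemma measurable_fun_sub_sigma d' (T : measurableType d') F (f : Omega -> T) :
  F `<=` measurable ->
  measurable_fun [set: g_sigma_algebraType F] f -> measurable_fun [set: Omega] f.
Proof.
move=> FM mf _ S mS; have : <<s F >> ([set: Omega] `&` f @^-1` S) by exact: mf.
by apply: smallest_sub => //; exact: sigma_algebra_measurable.
Qed.

(* The law of w |-> (w, w) on F * G is the product of the restrictions of P. *)
Lemma indep_integral F G (Phi : Omega -> Omega -> \bar R) :
  F `<=` measurable -> G `<=` measurable ->
  (forall A B, <<s F>> A -> <<s G>> B -> P (A `&` B) = (P A * P B)%E) ->
  (forall w1 w2, (0 <= Phi w1 w2)%E) ->
  measurable_fun [set: g_sigma_algebraType F * g_sigma_algebraType G]
    (fun w => Phi w.1 w.2) ->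
  (\int[P]_w Phi w w = \int[P]_w1 \int[P]_w2 Phi w1 w2)%E.
Proof.
move=> FM GM indep Phi0 mPhi.
pose TF := g_sigma_algebraType F; pose TG := g_sigma_algebraType G.
have mF : measurable_fun [set: Omega] (id : Omega -> TF).
  exact: measurable_fun_sub_sigma FM (@measurable_id _ TF _).
have mG : measurable_fun [set: Omega] (id : Omega -> TG).
  exact: measurable_fun_sub_sigma GM (@measurable_id _ TG _).
have mD : measurable_fun [set: Omega] (fun w => (w, w) : TF * TG).
  exact: measurable_fun_pair.
pose X : {mfun Omega >-> TF} := mfun_Sub (mem_set mF).
pose Y : {mfun Omega >-> TG} := mfun_Sub (mem_set mG).
pose XY : {mfun Omega >-> (TF * TG)%type} := mfun_Sub (mem_set mD).
transitivity (\int[distribution P XY]_z Phi z.1 z.2)%E.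
  by rewrite ge0_integral_distribution.
transitivity (\int[(distribution P X \x distribution P Y)%E]_z Phi z.1 z.2)%E.
  apply: eq_measure_integral => S mS _.
  exact/esym/product_measure_unique.
rewrite fubini_tonelli1// ge0_integral_distribution//; last 2 first.
- exact: measurable_fun_fubini_tonelli_F.
- by move=> w1; apply: integral_ge0.
apply: eq_integral => w1 _; rewrite /= /fubini_F ge0_integral_distribution//.
exact: (@measurable_fun_pair2 _ _ _ TF TG _ (fun w => Phi w.1 w.2) w1 mPhi).
Qed.

End sub_sigma_algebras.

Section almost_everywhere.
Context {R : realType} {d : measure_display} {Omega : measurableType d}.

(* Unlike ge0_le_integral, this needs no measurability: the integral of a
   nonnegative function is a supremum over the simple functions below it. *)
Lemma integral_le_pointwise (mu : {measure set Omega -> \bar R})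
    (f g : Omega -> \bar R) :
  (forall w, (0 <= f w)%E) -> (forall w, (f w <= g w)%E) ->
  (\int[mu]_w f w <= \int[mu]_w g w)%E.
Proof.
move=> f0 fg; have g0 w : (0 <= g w)%E by exact: le_trans (fg w).
rewrite !ge0_integralTE//; apply: ereal_sup_le => _ /= [h hf <-].
exists h => // w.
exact: le_trans (fg w).
Qed.

Context (P : probability Omega R).

(** Fatou's lemma, after trading [g] for the lower limit of [f], with which it agrees almost
    everywhere. *)
Lemma integral_le_of_ae_cvg (f : nat -> Omega -> R) (g : Omega -> R) (c : \bar R) :
  (forall n, measurable_fun setT (f n)) -> measurable_fun setT g ->
  (forall n w, 0 <= f n w) -> (forall w, 0 <= g w) ->
  {ae P, forall w, f n w @[n --> \oo] --> g w} ->
  (forall n, (\int[P]_w (f n w)%:E <= c)%E) ->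
  (\int[P]_w (g w)%:E <= c)%E.
Proof.
move=> mf mg f0 g0 fg fc.
have mEf n : measurable_fun setT (EFin \o f n) by exact/measurable_EFinP.
have -> : (\int[P]_w (g w)%:E = \int[P]_w limn_einf (fun n => (f n w)%:E))%E.
  apply: ge0_ae_eq_integral => //.
  - exact/measurable_EFinP.
  - rewrite /limn_einf; apply: measurableT_comp => //.
    apply: measurable_fun_limn_esup => n.
    by apply/measurable_EFinP; exact: measurableT_comp.
  - by move=> w _; rewrite lee_fin.
  - move=> w _; rewrite limn_einf_lim; apply: lime_ge; first exact: is_cvg_einfs.
    apply: nearW => n; apply: le_ereal_inf_tmp => _ [m /= _ <-].
    by rewrite lee_fin.
  - apply: filterS fg => w fgw _; apply/esym.
    have : (f n w)%:E @[n --> \oo] --> (g w)%:E.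
      by apply: cvg_EFin; [exact: nearW|exact: fgw].
    by move=> /cvg_limn_einf_sup[].
apply: (le_trans (fatou P measurableT mEf _)).
  by move=> n w _; rewrite lee_fin.
rewrite limn_einf_lim; apply: lime_le; first exact: is_cvg_einfs.
apply: nearW => n; apply: le_trans (fc n).
by apply: ereal_inf_lbound; exists n => /=.
Qed.

(** The second moments are summable, so the series of the squares has finite expectation, converges
    almost surely, and its terms vanish. *)
Lemma ae_cvg0_of_sqr (Z : nat -> Omega -> R) :
  (forall n, measurable_fun setT (Z n)) ->
  (forall n, (\int[P]_w (Z n w ^+ 2)%:E <= (1 / (2 ^ n.+1)%:R)%:E)%E) ->
  {ae P, forall w, Z n w @[n --> \oo] --> 0}.
Proof.
move=> mZ Zle.
have mZ2 n : measurable_fun setT (fun w => (Z n w ^+ 2)%:E).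
  by apply/measurable_EFinP; exact: measurable_funX.
have Z20 n w : (0 <= (Z n w ^+ 2)%:E)%E by rewrite lee_fin sqr_ge0.
pose S w := (\sum_(n <oo) (Z n w ^+ 2)%:E)%E.
have mS : measurable_fun setT S.
  by apply: ge0_emeasurable_sum => [n w _ _|n _].
have intS : (\int[P]_w S w < +oo)%E.
  rewrite integral_nneseries//.
  apply: (@le_lt_trans _ _ (\sum_(n <oo) (1 / (2 ^ n.+1)%:R)%:E)%E).
    apply: lee_nneseries => [n _ _|n _]; last exact: Zle.
    by apply: integral_ge0 => w _; exact: Z20.
  by apply: le_lt_trans (epsilon_trick0 _ ler01) _; exact: ltry.
have iS : P.-integrable setT S.
  apply/integrableP; split => //.
  by under eq_integral do rewrite gee0_abs ?nneseries_ge0//.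
apply: filterS (integrable_ae measurableT iS) => w /(_ I) Sw.
have Soo : (S w < +oo)%E by rewrite ltey_eq Sw.
have := cvg_series_cvg_0 (nnseries_is_cvg (fun n => sqr_ge0 (Z n w)) Soo).
move=> /cvgrPdist_lt Z2; apply/cvgrPdist_lt => e e0.
have := Z2 (e ^+ 2) (exprn_gt0 _ e0); apply: filterS => n.
rewrite !sub0r !normrN normrX => lt.
by rewrite -(ltr_pXn2r (n:=2))// ?nnegrE// ltW.
Qed.

(* The limit is modified on a null set only, and null sets belong to G. *)
Lemma measurable_fun_ae_cvg (G : set_system Omega) (f : nat -> Omega -> R)
    (g : Omega -> R) :
  (forall A, measurable A -> P A = 0%E -> <<s G>> A) ->
  measurable_fun [set: Omega] g ->
  (forall n, measurable_fun [set: g_sigma_algebraType G] (f n)) ->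
  {ae P, forall w, f n w @[n --> \oo] --> g w} ->
  measurable_fun [set: g_sigma_algebraType G] g.
Proof.
move=> null mg mf [N [mN PN0 fgN]].
have mN' : measurable (N : set (g_sigma_algebraType G)) by exact: null.
have mgN : measurable_fun (~` N : set (g_sigma_algebraType G)) g.
  apply: (@measurable_fun_cvg _ (g_sigma_algebraType G) R (~` N) f g).
    by move=> n; exact: measurable_funTS.
  by move=> w Nw; apply: contrapT => /fgN.
move=> _ S mS; rewrite setTI.
rewrite -(setIT (g @^-1` S)) -(setUv N) setIUr.
apply: measurableU.
  apply: null; first by apply: measurableI => //; rewrite -[X in measurable X]setTI; exact: mg.
  by apply/eqP; rewrite -measure_le0 -PN0 le_measure// ?inE//;
     apply: measurableI => //; rewrite -[X in measurable X]setTI; exact: mg.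
rewrite setIC; apply: mgN => //; exact: measurableC.
Qed.

End almost_everywhere.

(** * The tamed step from a random starting point *)

Section tamed_step.
Context {R : realType} {d : measure_display} {Omega : measurableType d}.
Context (P : probability Omega R) (I : eqType).

Lemma ae_cvg_sumsq (r : seq I) (f : nat -> I -> Omega -> R) (g : I -> Omega -> R) :
  (forall i, i \in r -> {ae P, forall w, f n i w @[n --> \oo] --> g i w}) ->
  {ae P, forall w, sumsq r ((f n)^~ w) @[n --> \oo] --> sumsq r (g^~ w)}.
Proof.
rewrite /sumsq; elim: r => [|i r IHr] fg.
  apply: aeW => w; under eq_cvg do rewrite big_nil.
  by rewrite big_nil; exact: cvg_cst.
have {}IHr := IHr (fun j jr => fg j (mem_behead (s:=i :: r) jr)).
apply: filterS2 (fg i (mem_head _ _)) IHr => w fi fr.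
under eq_cvg do rewrite big_cons.
by rewrite big_cons; apply: cvgD => //; rewrite !expr2; exact: cvgM.
Qed.

Lemma ae_cvg_tamed (r : seq I) (x : I -> Omega -> R) (c : Omega -> R)
    (X : nat -> I -> Omega -> R) (D : I -> Omega -> R) :
  (forall i, i \in r -> {ae P, forall w, X n i w @[n --> \oo] --> D i w}) ->
  forall i, i \in r -> {ae P, forall w,
    x i w + c w / (1 + sumsq r ((X n)^~ w)) * X n i w @[n --> \oo] -->
    x i w + c w / (1 + sumsq r (D^~ w)) * D i w}.
Proof.
move=> XD i ir; apply: filterS2 (XD i ir) (ae_cvg_sumsq XD) => w XDi XDs.
apply: cvgD; first exact: cvg_cst.
apply: cvgM => //; apply: cvgM; first exact: cvg_cst.
apply: cvgV; first by rewrite gt_eqF// ltr_wpDr// sumsq_ge0.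
by apply: cvgD => //; exact: cvg_cst.
Qed.

Lemma measurable_tamed d' (T : measurableType d') (r : seq I) (x X : I -> T -> R)
    (c : T -> R) (i : I) :
  (forall j, measurable_fun setT (x j)) -> measurable_fun setT c ->
  (forall j, measurable_fun setT (X j)) ->
  measurable_fun setT
    (fun w => x i w + c w / (1 + sumsq r (X^~ w)) * X i w).
Proof.
move=> mx mc mX; apply: measurable_funD => //; apply: measurable_funM => //.
by apply: measurable_funM => //; exact: measurable_inv_sumsq.
Qed.

Lemma measurable_expR_sumsq d' (T : measurableType d') (r : seq I)
    (x : I -> T -> R) (e : R) :
  (forall j, measurable_fun setT (x j)) ->
  measurable_fun setT (fun w => expR (e * sumsq r (x^~ w))).
Proof.
move=> mx; apply: measurableT_comp => //; apply: measurable_funM => //.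
exact: measurable_sumsq.
Qed.

(** The [G]-measurability that gives independence from [F] is available for the approximations
    [X n]. For each [n] the pair [(x, c)] is frozen and the estimate for a deterministic start is
    integrated over the noise; the resulting bound is free of [n], so it survives the limit to
    [D]. *)
Lemma tamed_step (F G : set_system Omega) (r : seq I) (x : I -> Omega -> R)
    (c : Omega -> R) (X : nat -> I -> Omega -> R) (D : I -> Omega -> R)
    (eps K : R) :
  0 < K -> 0 <= eps <= 44^-1 -> eps * K <= 44^-1 ->
  F `<=` measurable -> G `<=` measurable ->
  (forall A B, <<s F>> A -> <<s G>> B -> P (A `&` B) = (P A * P B)%E) ->
  (forall i, measurable_fun [set: g_sigma_algebraType F] (x i)) ->
  measurable_fun [set: g_sigma_algebraType F] c ->
  (forall w, 0 <= c w <= 1) ->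
  (forall n i, measurable_fun [set: g_sigma_algebraType G] (X n i)) ->
  (forall i, measurable_fun [set: Omega] (D i)) ->
  (forall n (l : I -> R),
    (\int[P]_w (expR (\sum_(i <- r) l i * X n i w))%:E <=
     (expR (K * sumsq r l / 2))%:E)%E) ->
  (forall n, (\int[P]_w (expR (sumsq r ((X n)^~ w) / (4 * K)))%:E <= 2%:E)%E) ->
  (forall i, i \in r -> {ae P, forall w, X n i w @[n --> \oo] --> D i w}) ->
  (\int[P]_w (expR (eps * sumsq r (fun i =>
      x i w + c w / (1 + sumsq r (D^~ w)) * D i w)))%:E <=
   \int[P]_w (expR ((eps + 20 * K * eps ^+ 2) * sumsq r (x^~ w) + 128 * K))%:E)%E.
Proof.
move=> K0 e0 eK FM GM indep mx mc c01 mX mD mgf sq2 XD.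
have mx' i := measurable_fun_sub_sigma FM (mx i).
have mc' := measurable_fun_sub_sigma FM mc.
have mX' n i := measurable_fun_sub_sigma GM (mX n i).
pose f n w := expR (eps * sumsq r (fun i =>
  x i w + c w / (1 + sumsq r ((X n)^~ w)) * X n i w)).
apply: (@integral_le_of_ae_cvg _ _ _ P f) => //.
- by move=> n; apply: measurable_expR_sumsq => i; exact: measurable_tamed.
- by apply: measurable_expR_sumsq => i; exact: measurable_tamed.
- by move=> n w; exact: expR_ge0.
- apply: filterS (ae_cvg_sumsq (ae_cvg_tamed x c XD)) => w cvg.
  apply: continuous_cvg; first exact: continuous_expR.
  by apply: cvgM => //; exact: cvg_cst.
move=> n; pose Phi w1 w2 := (expR (eps * sumsq r (fun i =>
  x i w1 + c w1 / (1 + sumsq r ((X n)^~ w2)) * X n i w2)))%:E.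
rewrite (@indep_integral _ _ _ P F G Phi)//.
- apply: integral_le_pointwise => w1.
    by apply: integral_ge0 => w2 _; rewrite lee_fin expR_ge0.
  exact: tamed_increment_expectation.
- by move=> w1 w2; rewrite lee_fin expR_ge0.
- apply/measurable_EFinP.
  pose T := (g_sigma_algebraType F * g_sigma_algebraType G)%type.
  pose x1 i (w : T) := x i w.1; pose X2 i (w : T) := X n i w.2.
  apply: (@measurable_expR_sumsq _ T r (fun i (w : T) =>
    x1 i w + c w.1 / (1 + sumsq r (X2^~ w)) * X2 i w)) => i.
  apply: (@measurable_tamed _ T r x1 X2 (c \o fst)) => [j||j].
  + exact: (measurableT_comp (mx j) measurable_fst).
  + exact: (measurableT_comp mc measurable_fst).
  + exact: (measurableT_comp (mX n j) measurable_snd).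
Qed.

End tamed_step.

(** * Inner products and Borel measurability *)

Section inner_product.
Context {R : realType} {H : completeNormedModType R} (ip : {dot H for idfun}).
Implicit Types x y : H.

Lemma ipC x y : ip x y = ip y x.
Proof. by rewrite hermC /= mul1r. Qed.

Lemma ipDr x y z : ip x (y + z) = ip x y + ip x z.
Proof. by rewrite linearDr. Qed.

Lemma ipBr x y z : ip x (y - z) = ip x y - ip x z.
Proof. by rewrite linearBr. Qed.

Lemma ipZr x (a : R) z : ip x (a *: z) = a * ip x z.
Proof. by rewrite linearZr_LR. Qed.

Lemma ip0r x : ip x 0 = 0.
Proof. by rewrite linear0r. Qed.

Lemma ip_sumr (I : Type) (r : seq I) (E : I -> H) x :
  ip x (\sum_(i <- r) E i) = \sum_(i <- r) ip x (E i).
Proof. by rewrite linear_sumr. Qed.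

Hypothesis ipE : induces_norm ip.

Lemma ip_sqr_le x y : ip x y ^+ 2 <= `|x| ^+ 2 * `|y| ^+ 2.
Proof.
have [->|y0] := eqVneq y 0; first by rewrite ip0r normr0 !expr0n mulr0.
have B0 : 0 < `|y| ^+ 2 by rewrite exprn_gt0// normr_gt0.
move: B0; set A := `|x| ^+ 2; set B := `|y| ^+ 2; set S := ip x y => B0.
have : 0 <= `|B *: x - S *: y| ^+ 2 by exact: sqr_ge0.
have xx : ip x x = A by rewrite -ipE.
have yy : ip y y = B by rewrite -ipE.
rewrite ipE ipBr !ipZr !(ipC (_ - _)) !ipBr !ipZr xx yy (ipC y x) -/S => le.
have : 0 <= B * (A * B - S ^+ 2) by move: le; congr (0 <= _); ring.
by rewrite pmulr_rge0// subr_ge0.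
Qed.

Lemma continuous_ip x : continuous (ip x : H -> R).
Proof.
move=> y; apply/cvgrPdist_lt => e e0.
near=> z; rewrite -ipBr -(ltr_pXn2r (n:=2))// ?nnegrE ?(ltW e0)// real_normK ?num_real//.
apply: le_lt_trans (ip_sqr_le _ _) _.
have lt : `|y - z| < e / (1 + `|x|).
  near: z; apply: (@cvgr_dist_lt _ _ _ (nbhs y) _ id y); first exact: cvg_id.
  by rewrite divr_gt0// ltr_wpDr.
have x1 : 0 < 1 + `|x| by rewrite ltr_wpDr.
rewrite -exprMn ltr_pXn2r ?nnegrE ?mulr_ge0 ?(ltW e0)//.
rewrite ltr_pdivlMr// in lt; apply: le_lt_trans lt.
by rewrite mulrC ler_wpM2l// lerDr.
Unshelve. all: by end_near. Qed.

Lemma normr_sum_orthonormal_sqr (E : set H) (r : seq H) (a : H -> R) :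
  (forall h k, E h -> E k -> ip h k = (h == k)%:R) -> uniq r ->
  (forall u, ~ E u -> a u = 0) ->
  `|\sum_(u <- r) a u *: u| ^+ 2 = \sum_(u <- r) a u ^+ 2.
Proof.
move=> orth ur a0; rewrite ipE ip_sumr; rewrite big_seq [RHS]big_seq.
apply: eq_bigr => u ru; rewrite ipZr ipC ip_sumr (bigD1_seq u)//= ipZr.
have [Eu|/a0 ->] := pselect (E u); last by rewrite !mul0r expr0n.
rewrite orth// eqxx big1 ?addr0 ?mulr1 ?expr2// => v vu.
rewrite ipZr; have [Ev|/a0 ->] := pselect (E v); last by rewrite mul0r.
by rewrite orth// eq_sym (negbTE vu) mulr0.
Qed.

End inner_product.

Section generated_measurability.
Context {R : realType} {d : measure_display} {Omega : measurableType d}.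
Implicit Types G : set_system Omega.

Lemma measurable_fun_open G (X : Omega -> R) :
  (forall V : set R, open V -> <<s G>> (X @^-1` V)) ->
  measurable_fun [set: g_sigma_algebraType G] X.
Proof.
move=> XG; apply: (measurability _ (RGenOInfty.measurableE R)) => //.
move=> _ [_ [a ->] <-]; rewrite setTI; apply: XG; exact: interval_open.
Qed.

Lemma measurable_fun_wrt G (X : Omega -> R) :
  measurable_wrt G X -> measurable_fun [set: g_sigma_algebraType G] X.
Proof.
move=> XG; apply: measurable_fun_open => V oV; apply: sub_gen_smallest.
by apply: XG; exact: sub_gen_smallest.
Qed.

Lemma measurable_fun_wrt_comp (V : topologicalType) G (X : Omega -> V) (f : V -> R) :
  measurable_wrt G X -> continuous f ->
  measurable_fun [set: g_sigma_algebraType G] (f \o X).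
Proof.
move=> XG cf; apply: measurable_fun_open => S oS; apply: sub_gen_smallest.
rewrite comp_preimage; apply: XG; apply: sub_gen_smallest.
by apply: open_comp => // x _; exact: cf.
Qed.

Lemma measurable_fun_wrtT (V : topologicalType) (X : Omega -> V) (f : V -> R) :
  measurable_wrt measurable X -> continuous f -> measurable_fun setT (f \o X).
Proof.
move=> XG cf; apply: (@measurable_fun_sub_sigma _ _ _ _ measurable) => //.
exact: measurable_fun_wrt_comp.
Qed.

End generated_measurability.

Lemma measurable_ip (R : realType) (H : completeNormedModType R)
    (ip : {dot H for idfun}) d (Omega : measurableType d) (X : Omega -> H) (h : H) :
  induces_norm ip -> measurable_wrt measurable X ->
  measurable_fun setT (fun w => ip h (X w)).
Proof.
move=> ipE mX; have := measurable_fun_wrtT mX (continuous_ip ipE (x:=h)).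
exact.
Qed.

Lemma sumsq_cauchy_schwarz (R : realType) (I : Type) (r : seq I) (a b : I -> R) :
  (\sum_(i <- r) a i * b i) ^+ 2 <= sumsq r a * sumsq r b.
Proof.
set S := \sum_(i <- r) a i * b i.
have key (c : R) : 0 <= sumsq r a - 2 * c * S + c ^+ 2 * sumsq r b.
  have -> : sumsq r a - 2 * c * S + c ^+ 2 * sumsq r b =
            sumsq r (fun i => a i - c * b i).
    rewrite /sumsq /S !mulr_sumr -sumrN -!big_split/=.
    by apply: eq_bigr => i _; ring.
  exact: sumsq_ge0.
have := sumsq_ge0 r b; rewrite le_eqVlt => /orP[/eqP b0|b0].
  have a0 := sumsq_ge0 r a; rewrite -b0 mulr0.
  have [->|S0] := eqVneq S 0; first by rewrite expr0n.
  (* Here the quadratic in [key] is affine in [c], and this [c] would bring it down to -1. *)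
  have := key ((sumsq r a + 1) / (2 * S)); rewrite -b0 mulr0 addr0.
  have -> : 2 * ((sumsq r a + 1) / (2 * S)) * S = sumsq r a + 1 by field.
  lra.
have := key (S / sumsq r b); rewrite -(ler_pM2r b0) mul0r.
have -> : (sumsq r a - 2 * (S / sumsq r b) * S + (S / sumsq r b) ^+ 2 * sumsq r b) *
   sumsq r b = sumsq r a * sumsq r b - S ^+ 2 by field; rewrite gt_eqF.
by rewrite subr_ge0.
Qed.

(** * Gaussian estimates for Wiener increments *)

Section wiener_increments.
Context {R : realType} {U : completeNormedModType R}.
Context {d : measure_display} {Omega : measurableType d}.
Context (P : probability Omega R) (T : R) (F : R -> set_system Omega).
Context (W : R -> U -> Omega -> R).
Hypothesis hF : usual_filtration P T F.
Hypothesis hW : cylindrical_wiener P T F W.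

Lemma filtration_gen (t : R) : 0 <= t <= T -> <<s F t>> = F t.
Proof.
move=> t0T; apply/seteqP; split; last exact: sub_gen_smallest.
by apply: smallest_sub => //; exact: (filtration_sigma hF t0T).
Qed.

Lemma wiener_measurable (t : R) (u : U) : 0 <= t <= T ->
  measurable_fun setT (W t u).
Proof.
move=> t0T; apply: (measurable_fun_sub_sigma (filtration_sub hF t0T)).
exact: (measurable_fun_wrt (wiener_adapted hW u t0T)).
Qed.

Lemma wiener_zero (t : R) : 0 <= t <= T -> {ae P, forall w, W t 0 w = 0}.
Proof.
move=> t0T; apply: filterS (wiener_linear hW 1 0 0 t0T) => w.
by rewrite scaler0 addr0 mul1r; lra.
Qed.

Lemma wiener_sum (t : R) (r : seq U) (a : U -> R) : 0 <= t <= T ->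
  {ae P, forall w, W t (\sum_(u <- r) a u *: u) w = \sum_(u <- r) a u * W t u w}.
Proof.
move=> t0T; elim: r => [|u r IHr].
  apply: filterS (wiener_zero t0T) => w.
  by rewrite !big_nil.
apply: filterS2 IHr (wiener_linear hW (a u) u (\sum_(u <- r) a u *: u) t0T) => w.
by rewrite !big_cons => <- <-.
Qed.

Context (s t : R) (s0 : 0 <= s) (st : s < t) (tT : t <= T).
Local Notation dW := (fun u w => W t u w - W s u w).

Let t0T : 0 <= t <= T. Proof. by rewrite tT andbT (le_trans s0)// ltW. Qed.
Let s0T : 0 <= s <= T. Proof. by rewrite s0 (le_trans (ltW st)). Qed.

Lemma increment_measurable (u : U) : measurable_fun setT (dW u).
Proof. by apply: measurable_funB; exact: wiener_measurable. Qed.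

Lemma increment_measurable_gen (u : U) :
  measurable_fun [set: g_sigma_algebraType (sigma_gen dW)] (dW u).
Proof.
apply: measurable_fun_open => V oV; apply: sub_gen_smallest.
by apply: sub_gen_smallest; exists u, V.
Qed.

Lemma sigma_gen_measurable : sigma_gen dW `<=` measurable.
Proof.
apply: smallest_sub; first exact: sigma_algebra_measurable.
move=> _ [u [V [oV ->]]]; rewrite -[X in measurable X]setTI.
by apply: increment_measurable => //; exact: open_measurable.
Qed.

Lemma increment_indep A B : <<s F s>> A -> <<s sigma_gen dW>> B ->
  P (A `&` B) = (P A * P B)%E.
Proof.
rewrite filtration_gen// /sigma_gen.
rewrite (_ : <<s <<s ?[G] >> >> = <<s ?G >>); first exact: (wiener_indep hW).
apply/seteqP; split; last exact: sub_gen_smallest.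
by apply: smallest_sub => //; exact: smallest_sigma_algebra.
Qed.

Lemma increment_sum (r : seq U) (a : U -> R) :
  {ae P, forall w, dW (\sum_(u <- r) a u *: u) w = \sum_(u <- r) a u * dW u w}.
Proof.
apply: filterS2 (wiener_sum r a t0T) (wiener_sum r a s0T) => w -> ->.
by rewrite -sumrB; apply: eq_bigr => u _; rewrite mulrBr.
Qed.

Lemma increment_mgf (y : U) :
  (\int[P]_w (expR (dW y w))%:E = (expR ((t - s) * `|y| ^+ 2 / 2))%:E)%E.
Proof.
(* [wiener_gauss] excludes the zero direction, where [W] vanishes almost surely by linearity. *)
have [->|y0] := eqVneq y 0.
  rewrite normr0 expr0n/= mulr0 mul0r expR0.
  transitivity (\int[P]_w (1%:E : \bar R))%E; last first.
    by rewrite integral_cst//= probability_setT mule1.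
  apply: ge0_ae_eq_integral => //.
    apply/measurable_EFinP; apply: measurableT_comp => //.
    exact: increment_measurable.
  apply: filterS2 (wiener_zero t0T) (wiener_zero s0T) => w -> -> _.
  by rewrite subrr expR0.
have st0 : 0 < t - s by rewrite subr_gt0.
have sig0 : Num.sqrt (t - s) * `|y| != 0.
  by rewrite mulf_neq0 ?normr_eq0// gt_eqF// sqrtr_gt0.
have := gaussian_mgf 1 sig0 (increment_measurable y) (wiener_gauss hW s0 st tT y0).
rewrite expr1n mul1r exprMn sqr_sqrtr ?(ltW st0)// => <-.
by under [RHS]eq_integral do rewrite mul1r.
Qed.

(** The expectation is [Num.sqrt 2] for nonzero [y]; at [y = 0] the exponent takes the default value
    [x / 0 = 0]. *)
Lemma increment_expR_sqr (y : U) :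
  (\int[P]_w (expR (dW y w ^+ 2 / (4 * ((t - s) * `|y| ^+ 2))))%:E <= 2%:E)%E.
Proof.
have [->|y0] := eqVneq y 0.
  under eq_integral do rewrite normr0 expr0n/= !mulr0 invr0 mulr0 expR0.
  by rewrite integral_cst//= probability_setT mule1 lee_fin; lra.
have st0 : 0 < t - s by rewrite subr_gt0.
have sig0 : Num.sqrt (t - s) * `|y| != 0.
  by rewrite mulf_neq0 ?normr_eq0// gt_eqF// sqrtr_gt0.
have := gaussian_expR_sqr sig0 (increment_measurable y) (wiener_gauss hW s0 st tT y0).
rewrite exprMn sqr_sqrtr ?(ltW st0)// => ->.
rewrite lee_fin -(ler_pXn2r (n:=2))// ?nnegrE// sqr_sqrtr//; lra.
Qed.

Context (ipU : {dot U for idfun}) (hU : induces_norm ipU) (UU : set U).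
Hypothesis orthU : forall u v, UU u -> UU v -> ipU u v = (u == v)%:R.
Context (I : Type) (r : seq I) (b : I -> U -> R) (L : R).
Hypothesis b0 : forall i u, ~ UU u -> b i u = 0.
Context (A : seq U) (uA : uniq A).
Hypothesis bL : \sum_(i <- r) \sum_(u <- A) b i u ^+ 2 <= L.
Hypothesis L0 : 0 < L.
Local Notation X := (fun i w => \sum_(u <- A) b i u * dW u w).

(** By linearity of [W] the double sum is almost surely a single increment, in the direction with
    coefficients [a u], so one Gaussian variable suffices. Cauchy-Schwarz in [i] bounds the squared
    norm of that direction by [L * sumsq r l]. *)
Lemma increment_sum_mgf (l : I -> R) :
  (\int[P]_w (expR (\sum_(i <- r) l i * X i w))%:E <=
   (expR ((t - s) * L * sumsq r l / 2))%:E)%E.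
Proof.
pose a u := \sum_(i <- r) l i * b i u.
have a0 u : ~ UU u -> a u = 0.
  by move=> u0; rewrite /a big1// => i _; rewrite b0// mulr0.
have XE w : \sum_(i <- r) l i * X i w = \sum_(u <- A) a u * dW u w.
  under eq_bigr do rewrite mulr_sumr.
  rewrite exchange_big/=; apply: eq_bigr => u _; rewrite /a mulr_suml.
  by apply: eq_bigr => i _; rewrite mulrA.
have -> : (\int[P]_w (expR (\sum_(i <- r) l i * X i w))%:E =
           \int[P]_w (expR (dW (\sum_(u <- A) a u *: u) w))%:E)%E.
  apply: ge0_ae_eq_integral => //.
  - apply/measurable_EFinP; apply: measurableT_comp => //.
    apply: measurable_sum => i; apply: measurable_funM => //.
    apply: measurable_sum => u; apply: measurable_funM => //.
    exact: increment_measurable.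
  - apply/measurable_EFinP; apply: measurableT_comp => //.
    exact: increment_measurable.
  - by apply: filterS (increment_sum A a) => w e _; rewrite XE e.
rewrite increment_mgf lee_fin ler_expR ler_pM2r// -mulrA ler_pM2l ?subr_gt0//.
rewrite (normr_sum_orthonormal_sqr hU orthU uA a0).
apply: (@le_trans _ _ (\sum_(u <- A) (sumsq r l * sumsq r (b^~ u)))).
  by apply: ler_sum => u _; exact: sumsq_cauchy_schwarz.
rewrite -mulr_sumr mulrC ler_wpM2r ?sumsq_ge0//.
by rewrite /sumsq exchange_big.
Qed.

(** Almost surely [X i] is the increment in a direction of squared norm [\sum_u b i u ^+ 2]; the
    variances add up to at most [(t - s) * L]. *)
Lemma increment_sum_expR_sumsq :
  (\int[P]_w (expR (sumsq r (X^~ w) / (4 * ((t - s) * L))))%:E <= 2%:E)%E.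
Proof.
have st0 : 0 < t - s by rewrite subr_gt0.
have sum0 i : 0 <= \sum_(u <- A) b i u ^+ 2 by exact: sumsq_ge0.
have mX i : measurable_fun setT (X i).
  apply: measurable_sum => u; apply: measurable_funM => //.
  exact: increment_measurable.
apply: (@expectation_expR_sumsq_le2 _ _ _ P I r X
  (fun i => (t - s) * \sum_(u <- A) b i u ^+ 2)) => //.
- by rewrite mulr_gt0.
- by move=> i; rewrite mulr_ge0// ltW.
- by rewrite -mulr_sumr ler_pM2l.
- move=> i.
  rewrite -(normr_sum_orthonormal_sqr hU orthU uA (b0 i)).
  apply: le_trans (increment_expR_sqr (\sum_(u <- A) b i u *: u)).
  rewrite le_eqVlt; apply/orP; left; apply/eqP.
  apply: ge0_ae_eq_integral => //.
  + apply/measurable_EFinP; apply: measurableT_comp => //.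
    by apply: measurable_funM => //; apply: measurable_funX.
  + apply/measurable_EFinP; apply: measurableT_comp => //.
    apply: measurable_funM => //; apply: measurable_funX.
    exact: increment_measurable.
  + by apply: filterS (increment_sum A (b i)) => w e _; rewrite e.
(* Zero variance forces every [b i u] with [u] in [A] to vanish, so [X i] is zero everywhere and not
   just almost surely. *)
- move=> i w /eqP; rewrite mulf_eq0 gt_eqF//= => /eqP q0.
  have : sumsq A (b i) = 0 by [].
  move=> /eqP; rewrite psumr_eq0; last by move=> u _; exact: sqr_ge0.
  move=> /allP bi0; rewrite big_seq big1// => u /bi0.
  by rewrite /= sqrf_eq0 => /eqP ->; rewrite mul0r.
Qed.

End wiener_increments.

(* Coordinates of stochastic integrals along the net of finite sums *)
#[local] Existing Instance summability.totally_filter.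

Lemma near_forall_lt (T : Type) (G : set_system T) {FG : Filter G} (n : nat)
    (Q : nat -> T -> Prop) :
  (forall k, (k < n)%N -> \forall x \near G, Q k x) ->
  \forall x \near G, forall k, (k < n)%N -> Q k x.
Proof.
elim: n => [|n IHn] QG; first exact: nearW.
have QGn := IHn (fun k kn => QG k (ltnW kn)).
apply: filterS2 (QG n (ltnSn n)) QGn => x Qn Qk k.
by rewrite ltnS leq_eqVlt => /orP[/eqP ->|/Qk].
Qed.

Lemma psumE (R : realType) (K V : completeNormedModType R) (S : set K) (f : K -> V)
    (A : {fset K}) :
  psum S f A = \sum_(h <- A) (if h \in S then f h else 0).
Proof.
rewrite /psum /summability.partial_sum.
by rewrite -(big_seq_fsetE _ A predT (fun h => if h \in S then f h else 0)).
Qed.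

Section stochastic_integral_coordinates.
Context {R : realType} {U H : completeNormedModType R}.
Context {d : measure_display} {Omega : measurableType d}.
Context (P : probability Omega R) (T : R) (F : R -> set_system Omega).
Context (W : R -> U -> Omega -> R).
Hypothesis hF : usual_filtration P T F.
Hypothesis hW : cylindrical_wiener P T F W.
Context (ipH : {dot H for idfun}) (hH : induces_norm ipH) (UU : set U).

Definition coord_sum (h : H) (Phi : Omega -> U -> H) (s t : R)
    (A : {fset U}) (w : Omega) : R :=
  \sum_(u <- A) (if u \in UU then ipH h (Phi w u) else 0) * (W t u w - W s u w).

Lemma ip_psum h Phi s t A w :
  ipH h (psum UU (fun u => (W t u w - W s u w) *: Phi w u) A) =
  coord_sum h Phi s t A w.
Proof.
rewrite psumE ip_sumr; apply: eq_bigr => u _; case: ifP => _; last by rewrite ip0r mul0r.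
by rewrite ipZr mulrC.
Qed.

Lemma measurable_coord_sum h Phi s t A : 0 <= s <= T -> 0 <= t <= T ->
  (forall u, measurable_fun setT (fun w => ipH h (Phi w u))) ->
  measurable_fun setT (coord_sum h Phi s t A).
Proof.
move=> sT tT mPhi; apply: measurable_sum => u; apply: measurable_funM.
  by case: (u \in UU); [exact: mPhi|exact: measurable_cst].
by apply: measurable_funB; exact: (wiener_measurable hF hW).
Qed.

Lemma increment_image_coord s t (Psi : Omega -> U -> H) (Y : Omega -> H) h e :
  `|h| <= 1 -> is_increment_image P UU F W s t Psi Y -> 0 < e ->
  \forall A \near summability.totally,
    (\int[P]_w ((ipH h (Y w) - coord_sum h Psi s t A w) ^+ 2)%:E <= e%:E)%E.
Proof.
move=> h1 [_ _ _ _ Ycvg] e0.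
have : \forall A \near summability.totally,
    (\int[P]_w (`|Y w - psum UU (fun u => (W t u w - W s u w) *: Psi w u) A|
        ^+ 2)%:E < e%:E)%E.
  apply: (Ycvg [set x | (x < e%:E)%E]); apply: open_nbhs_nbhs; split.
    exact: open_ereal_lt_ereal.
  by rewrite /= lte_fin.
apply: filterS => A /ltW; apply: le_trans.
apply: integral_le_pointwise => w; first by rewrite lee_fin sqr_ge0.
rewrite -ip_psum -ipBr lee_fin; apply: (le_trans (ip_sqr_le hH _ _)).
by rewrite ler_piMl ?sqr_ge0// exprn_ile1.
Qed.

(** The integrand is constant in time, yet the definition leaves the partition free. All pieces
    share the coefficients [ipH h (Phi w u)], so their Wiener increments telescope to the one from
    [a] to [b]. *)
Lemma stoch_integral_coord a b (Phi : Omega -> U -> H) (X : Omega -> H) h e :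
  0 <= a -> a < b -> b <= T -> `|h| <= 1 ->
  (forall u, measurable_fun setT (fun w => ipH h (Phi w u))) ->
  is_stoch_integral P UU F W a b (fun _ => Phi) X -> 0 < e ->
  \forall A \near summability.totally,
    (\int[P]_w ((ipH h (X w) - coord_sum h Phi a b A w) ^+ 2)%:E <= e%:E)%E.
Proof.
move=> a0 ab bT h1 mPhi [n [p [Psi [Y [[pa pb] pmono PhiPsi YPsi [mX XY]]]]]] e0.
have p_le i j : (i <= j)%N -> (j <= n)%N -> p i <= p j.
  move=> ij; rewrite -(subnKC ij); elim: (j - i)%N => [|k IHk] kn.
    by rewrite addn0.
  by rewrite addnS in kn *; apply: le_trans (IHk (ltnW kn)) (pmono _ kn).
have pT k : (k <= n)%N -> 0 <= p k <= T.
  move=> kn; rewrite (le_trans a0) -?pa ?p_le//=.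
  by rewrite (le_trans _ bT)// -pb p_le.
have coordE k w A : (k < n)%N ->
    coord_sum h (Psi k) (p k) (p k.+1) A w = coord_sum h Phi (p k) (p k.+1) A w.
  (* On an empty interval [Psi k] is not tied to [Phi], but there the Wiener increment is 0. *)
  move=> kn; have := pmono _ kn; rewrite le_eqVlt => /orP[/eqP pk|pk].
    by rewrite /coord_sum pk; apply: eq_bigr => u _; rewrite subrr !mulr0.
  by rewrite (PhiPsi k (p k.+1))// pk lexx.
have sumE w A : coord_sum h Phi a b A w =
    \sum_(k < n) coord_sum h Phi (p k) (p k.+1) A w.
  rewrite exchange_big/=; apply: eq_bigr => u _; rewrite -mulr_sumr; congr (_ * _).
  rewrite -pa -pb -(big_mkord predT (fun k => W (p k.+1) u w - W (p k) u w)).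
  by rewrite telescope_sumr.
have n0 : (0 < n)%N.
  by rewrite lt0n; apply: contraTneq ab => n0; rewrite -pa -pb n0 ltxx.
have n0R : 0 < n%:R :> R by rewrite ltr0n.
(* One factor [n] pays for bounding the square of a sum by [n] times the sum of squares, the other
   for summing over [k]. *)
pose e' := e / (n%:R * n%:R).
have e'0 : 0 < e' by rewrite divr_gt0// mulr_gt0.
have near_k k : (k < n)%N -> \forall A \near summability.totally,
    (\int[P]_w ((ipH h (Y k w) - coord_sum h Phi (p k) (p k.+1) A w) ^+ 2)%:E
      <= e'%:E)%E.
  move=> kn; apply: filterS (increment_image_coord h1 (YPsi k kn) e'0) => A.
  by under eq_integral do rewrite coordE//.
apply: filterS (near_forall_lt near_k) => A le.
pose z k w := ipH h (Y k w) - coord_sum h Phi (p k) (p k.+1) A w.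
have mY k : (k < n)%N -> measurable_fun setT (fun w => ipH h (Y k w)).
  move=> kn; have [_ _ _ mYk _] := YPsi k kn.
  exact: measurable_ip.
have mz (k : 'I_n) : measurable_fun setT (z k).
  apply: measurable_funB; first exact: mY.
  by apply: measurable_coord_sum => //; apply: pT => //; exact: ltnW.
have T0ab : 0 <= a <= T /\ 0 <= b <= T.
  by rewrite a0 (le_trans (ltW ab))// bT (le_trans a0)// ltW.
apply: (@le_trans _ _ (\int[P]_w (n%:R%:E * \sum_(k < n) (z k w ^+ 2)%:E))%E).
  apply: ae_ge0_le_integral => //.
  - by move=> w _; rewrite lee_fin sqr_ge0.
  - apply/measurable_EFinP; apply: measurable_funX; apply: measurable_funB.
      exact: measurable_ip.
    by apply: measurable_coord_sum => //; case: T0ab.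
  - by move=> w _; rewrite mule_ge0// sume_ge0// => k _; rewrite lee_fin sqr_ge0.
  - apply: emeasurable_funM => //; apply: emeasurable_sum => k.
    by apply/measurable_EFinP; exact: measurable_funX.
  apply: filterS XY => w XYw _.
  have -> : ipH h (X w) - coord_sum h Phi a b A w = \sum_(k < n) 1 * z k w.
    rewrite XYw ip_sumr sumE -sumrB; apply: eq_bigr => k _.
    by rewrite mul1r.
  rewrite sumEFin -EFinM lee_fin.
  apply: (le_trans (sumsq_cauchy_schwarz _ _ _)).
  by rewrite /sumsq expr1n sumr_const card_ord.
rewrite ge0_integralZl//; last 2 first.
- apply: emeasurable_sum => k.
  by apply/measurable_EFinP; exact: measurable_funX.
- by move=> w _; rewrite sume_ge0// => k _; rewrite lee_fin sqr_ge0.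
rewrite ge0_integral_sum//; last 2 first.
- by move=> k; apply/measurable_EFinP; exact: measurable_funX.
- by move=> k w _; rewrite lee_fin sqr_ge0.
apply: (@le_trans _ _ (n%:R%:E * \sum_(k < n) e'%:E)%E).
  rewrite lee_wpmul2l ?lee_fin ?ler0n// lee_sum// => k _.
  exact: le.
rewrite sumEFin sumr_const card_ord -EFinM lee_fin -[e' *+ n]mulr_natl mulrA.
by rewrite mulrC divfK// mulf_neq0// gt_eqF.
Qed.

End stochastic_integral_coordinates.

(** * Orthonormal expansions and diagonal operators *)

Section orthonormal_expansions.
Context {R : realType} {H : completeNormedModType R}.

(** The net is constant on finite sets containing [r]. *)
Lemma hsum_finite (V : completeNormedModType R) (S : set H) (f : H -> V)
    (r : seq H) : uniq r -> (forall h, h \in r -> S h) ->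
  (forall h, S h -> h \notin r -> f h = 0) ->
  hsum S f = \sum_(h <- r) f h.
Proof.
move=> ur rS f0; rewrite /hsum; apply/cvg_lim; first exact: norm_hausdorff.
apply: (@cvg_near_cst _ _ _ (psum S f)).
exists [fset h in r]%fset => // A /= rA; rewrite psumE.
rewrite (bigID (mem r))/= [X in _ + X]big1 ?addr0; last first.
  by move=> h hr; case: ifPn => // /set_mem Sh; exact: f0.
rewrite -big_filter (perm_big r)/=; last first.
  apply: uniq_perm => //; first by rewrite filter_uniq// fset_uniq.
  move=> h; rewrite mem_filter; case: (boolP (h \in r)) => //= hr.
  by apply: (fsubsetP rA); rewrite in_fset.
by rewrite big_seq [RHS]big_seq; apply: eq_bigr => h hr; rewrite mem_set//; exact: rS.
Qed.

Context (ip : {dot H for idfun}) (ipE : induces_norm ip) (E : set H).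
Hypothesis orth : forall h k, E h -> E k -> ip h k = (h == k)%:R.

Lemma ip_expansion (r : seq H) (a : H -> R) (k : H) : uniq r ->
  (forall h, h \in r -> E h) -> k \in r ->
  ip k (\sum_(h <- r) a h *: h) = a k.
Proof.
move=> ur rE kr; rewrite ip_sumr (bigD1_seq k)//= ipZr (orth (rE _ kr) (rE _ kr)) eqxx mulr1.
rewrite big_seq_cond big1 ?addr0// => h /andP[hr hk].
by rewrite ipZr (orth (rE _ kr) (rE _ hr)) eq_sym (negbTE hk) mulr0.
Qed.

Lemma normr_expansion_sqr (r : seq H) (a : H -> R) : uniq r ->
  (forall h, h \in r -> E h) ->
  `|\sum_(h <- r) a h *: h| ^+ 2 = sumsq r a.
Proof.
move=> ur rE; rewrite ipE ip_sumr /sumsq big_seq [RHS]big_seq.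
apply: eq_bigr => h hr; rewrite ipZr ipC.
by rewrite (ip_expansion a ur rE hr) expr2.
Qed.

Lemma bessel (r : seq H) (x : H) : uniq r -> (forall h, h \in r -> E h) ->
  sumsq r (ip^~ x) <= `|x| ^+ 2.
Proof.
move=> ur rE; pose p := \sum_(h <- r) ip h x *: h.
have : 0 <= `|x - p| ^+ 2 by exact: sqr_ge0.
have pp := normr_expansion_sqr (ip^~ x) ur rE.
have xp : ip x p = sumsq r (ip^~ x).
  by rewrite /p ip_sumr; apply: eq_bigr => h _; rewrite ipZr ipC expr2.
rewrite ipE ipBr (ipC ip _ x) (ipC ip _ p) !ipBr (ipC ip p x) xp -!ipE pp.
by lra.
Qed.

End orthonormal_expansions.

Section diagonal_operators.
Context {R : realType} {H : completeNormedModType R}.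
Context (ip : {dot H for idfun}) (ipE : induces_norm ip) (E : set H).
Hypothesis orth : forall h k, E h -> E k -> ip h k = (h == k)%:R.

Lemma psum_sub (f : H -> H) (A B : {fset H}) : (A `<=` B)%fset ->
  psum E f B - psum E f A = psum E f (B `\` A)%fset.
Proof.
move=> AB; rewrite !psumE.
rewrite [X in X - _](perm_big (enum_fset A ++ enum_fset (B `\` A)%fset)).
  by rewrite big_cat/= addrAC subrr add0r.
apply: uniq_perm; first exact: fset_uniq.
  rewrite cat_uniq !fset_uniq/= andbT -all_predC; apply/allP => h.
  by rewrite in_fsetD => /andP[].
move=> h; rewrite mem_cat in_fsetD.
by case: (boolP (h \in A)) => //= hA; apply/idP; apply: (fsubsetP AB).
Qed.

Lemma psum_filter (f : H -> H) (A : {fset H}) :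
  psum E f A = \sum_(h <- [seq h <- A | h \in E]) f h.
Proof. by rewrite psumE -big_mkcond big_filter. Qed.

Lemma normr_psum_sqr (a : H -> R) (A : {fset H}) :
  `|psum E (fun h => a h *: h) A| ^+ 2 = sumsq [seq h <- A | h \in E] a.
Proof.
rewrite psum_filter (normr_expansion_sqr ipE orth)//.
  by rewrite filter_uniq// fset_uniq.
by move=> h; rewrite mem_filter => /andP[/set_mem].
Qed.

Lemma sumsq_le_esum (K : choiceType) (S : set K) (a : K -> R) (r : seq K) :
  uniq r -> (forall h, h \in r -> S h) ->
  ((sumsq r a)%:E <= \esum_(h in S) ((`|a h| ^+ 2)%:E))%E.
Proof.
move=> ur rS; apply: esum_ge; exists [set` r].
  by split=> [|h /= /rS]; first exact: finite_seq.
rewrite -fsbig_seq// sumEFin lee_fin /sumsq le_eqVlt; apply/orP; left.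
by apply/eqP; apply: eq_bigr => h _; rewrite real_normK ?num_real.
Qed.

(** [diag_op] is a [lim], meaningful once its net converges. The squared norm of a difference of
    partial sums is a sum of squares, which is small outside a finite set that nearly exhausts the
    total [S]; so the net is Cauchy. *)
Lemma cvg_diag_op (m : H -> R) (x : H) : diag_dom ip E m x ->
  psum E (fun h => (m h * ip h x) *: h) @ summability.totally -->
  diag_op ip E m x.
Proof.
move=> domx; pose a h := m h * ip h x.
have Sge0 : (0 <= \esum_(h in E) ((`|a h| ^+ 2)%:E))%E.
  by apply: esum_ge0 => h _; rewrite lee_fin sqr_ge0.
have Sfin : \esum_(h in E) ((`|a h| ^+ 2)%:E) \is a fin_num.
  by rewrite ge0_fin_numE.
apply: cauchy_cvg; apply: cauchy_exP => e e0.
set S := \esum_(h in E) _ in Sge0 Sfin.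
have /ereal_sup_gt[_ [X [finX XE] <-]] : (S - (e ^+ 2)%:E < S)%E.
  by rewrite lteBlDr// lteDl// lte_fin exprn_gt0.
rewrite fsbig_finite//= => ltX.
pose A0 := fset_set X.
exists (psum E (fun h => a h *: h) A0); exists A0 => // A /= A0A.
rewrite -ball_normE /= distrC psum_sub//.
rewrite -(ltr_pXn2r (n:=2))// ?nnegrE ?(ltW e0)// normr_psum_sqr.
set r := [seq h <- _ | _].
have A0X h : (h \in A0) = (h \in X) by rewrite in_fset_set.
have ur : uniq (enum_fset A0 ++ r).
  rewrite cat_uniq fset_uniq filter_uniq ?fset_uniq//= andbT -all_predC.
  by apply/allP => h; rewrite mem_filter in_fsetD => /andP[_ /andP[]].
have rE h : h \in enum_fset A0 ++ r -> E h.
  rewrite mem_cat => /orP[|]; first by rewrite A0X => /set_mem /XE.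
  by rewrite mem_filter => /andP[/set_mem].
have := sumsq_le_esum a ur rE; rewrite -/S /sumsq big_cat/=.
move: ltX; rewrite sumEFin -/A0.
rewrite (eq_bigr (fun h => a h ^+ 2)); last first.
  by move=> h _; rewrite real_normK ?num_real.
have -> : S = (fine S)%:E by rewrite fineK.
rewrite -EFinB lte_fin lee_fin; lra.
Qed.

Lemma ip_diag_op (m : H -> R) (x h : H) : diag_dom ip E m x -> E h ->
  ip h (diag_op ip E m x) = m h * ip h x.
Proof.
move=> domx Eh.
have c : ip h (psum E (fun k => (m k * ip k x) *: k) A)
    @[A --> summability.totally] --> ip h (diag_op ip E m x).
  by apply: continuous_cvg; [exact: continuous_ip|exact: cvg_diag_op].
apply: (cvg_unique _ c); first exact: norm_hausdorff.
apply: cvg_near_cst; exists [fset h]%fset => // A /= hA.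
rewrite psum_filter (ip_expansion orth (fun k => m k * ip k x))//.
- by rewrite filter_uniq// fset_uniq.
- by move=> k; rewrite mem_filter => /andP[/set_mem].
- by rewrite mem_filter mem_set//=; apply: (fsubsetP hA); rewrite inE.
Qed.

(** For powers of [-A] this is the continuous embedding of H_beta into H. On partial sums it follows
    from Bessel's inequality for the image, whose coordinates are [m h * ip h x]. *)
Lemma normr_le_diag_op (m : H -> R) (c : R) (x : H) :
  (psum E (fun h => ip h x *: h) @ summability.totally --> x) ->
  diag_dom ip E m x -> 0 <= c -> (forall h, E h -> c <= m h) ->
  c * `|x| <= `|diag_op ip E m x|.
Proof.
move=> cx domx c0 cm.
have cn : c * `|psum E (fun h => ip h x *: h) A| @[A --> summability.totally]
    --> c * `|x|.
  by apply: cvgM; [exact: cvg_cst|exact: cvg_norm].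
rewrite -(cvg_lim _ cn)//; apply: limr_le; first by apply/cvg_ex; exists (c * `|x|).
apply: nearW => A.
rewrite -(ler_pXn2r (n:=2))// ?nnegrE ?mulr_ge0// exprMn normr_psum_sqr.
set r := [seq h <- _ | _].
have ur : uniq r by rewrite filter_uniq// fset_uniq.
have rE h : h \in r -> E h by rewrite mem_filter => /andP[/set_mem].
apply: le_trans (bessel ipE orth _ ur rE).
rewrite /sumsq mulr_sumr big_seq [leRHS]big_seq; apply: ler_sum => h hr.
rewrite ip_diag_op//; last exact: rE.
rewrite exprMn ler_wpM2r ?sqr_ge0// ler_pXn2r ?nnegrE//; first exact/cm/rE.
by apply: le_trans (cm _ (rE _ hr)).
Qed.

End diagonal_operators.

(** * Finite-rank projections and the range of the integrals *)

Section finite_projections.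
Context {R : realType} {H : completeNormedModType R}.
Context (ip : {dot H for idfun}) (r : seq H).

(** A finite sum replaces the limit in [basis_proj]; lying in the range is expressed below by
    [proj x = x]. *)
Definition proj (x : H) : H := \sum_(h <- r) ip h x *: h.

Lemma projD x y : proj (x + y) = proj x + proj y.
Proof.
by rewrite -big_split; apply: eq_bigr => h _; rewrite ipDr scalerDl.
Qed.

Lemma projZ (a : R) x : proj (a *: x) = a *: proj x.
Proof. by rewrite scaler_sumr; apply: eq_bigr => h _; rewrite ipZr scalerA. Qed.

Lemma proj0 : proj 0 = 0.
Proof. by rewrite -(scale0r 0) projZ !scale0r. Qed.

Lemma proj_sum (I : Type) (s : seq I) (f : I -> H) :
  (forall i, proj (f i) = f i) ->
  proj (\sum_(i <- s) f i) = \sum_(i <- s) f i.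
Proof.
move=> pf; elim: s => [|i s IHs]; first by rewrite !big_nil proj0.
by rewrite !big_cons projD IHs pf.
Qed.

Hypothesis ipE : induces_norm ip.
Context (E : set H) (orth : forall h k, E h -> E k -> ip h k = (h == k)%:R).
Hypothesis ur : uniq r.
Hypothesis rE : forall h, h \in r -> E h.

Lemma proj_coord x : proj x = x -> `|x| ^+ 2 = sumsq r (ip^~ x).
Proof. by move=> px; rewrite -{1}px (normr_expansion_sqr ipE orth). Qed.

Lemma normr_sub_expansion_sqr x (c : H -> R) :
  `|x - \sum_(h <- r) c h *: h| ^+ 2 =
  `|x| ^+ 2 - sumsq r (ip^~ x) + sumsq r (fun h => ip h x - c h).
Proof.
set y := \sum_(h <- r) c h *: h.
have xy : ip x y = \sum_(h <- r) c h * ip h x.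
  by rewrite ip_sumr; apply: eq_bigr => h _; rewrite ipZr ipC.
rewrite ipE ipBr (ipC ip _ x) (ipC ip _ y) !ipBr (ipC ip y x) -!ipE.
rewrite (normr_expansion_sqr ipE orth c ur rE).
have -> : sumsq r (fun h => ip h x - c h) =
          sumsq r (ip^~ x) - 2 * ip x y + sumsq r c.
  rewrite xy /sumsq mulr_sumr -sumrN -!big_split/=.
  by apply: eq_bigr => h _; ring.
by ring.
Qed.

Lemma proj_dist_sqr x : `|x - proj x| ^+ 2 = `|x| ^+ 2 - sumsq r (ip^~ x).
Proof.
rewrite normr_sub_expansion_sqr [X in _ + X]big1 ?addr0// => h _.
by rewrite subrr expr0n.
Qed.

Lemma proj_best x y : proj y = y -> `|x - proj x| ^+ 2 <= `|x - y| ^+ 2.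
Proof.
move=> <-; rewrite proj_dist_sqr normr_sub_expansion_sqr lerDl.
exact: sumsq_ge0.
Qed.

End finite_projections.

Section stochastic_integral_range.
Context {R : realType} {U H : completeNormedModType R}.
Context {d : measure_display} {Omega : measurableType d}.
Context (P : probability Omega R) (F : R -> set_system Omega).
Context (W : R -> U -> Omega -> R) (UU : set U).
Context (ip : {dot H for idfun}) (ipE : induces_norm ip) (r : seq H).
Context (E : set H) (orth : forall h k, E h -> E k -> ip h k = (h == k)%:R).
Hypothesis ur : uniq r.
Hypothesis rE : forall h, h \in r -> E h.

(** The approximating sums lie in the range, where [proj] gives the point closest to [Y]. The mean
    squared distance of [Y] to the range is thus below every error of the net, and these tend to
    0. *)
Lemma increment_image_range s t (Psi : Omega -> U -> H) (Y : Omega -> H) :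
  is_increment_image P UU F W s t Psi Y ->
  (forall w u, proj ip r ((W t u w - W s u w) *: Psi w u) =
               (W t u w - W s u w) *: Psi w u) ->
  {ae P, forall w, proj ip r (Y w) = Y w}.
Proof.
move=> [_ _ _ mY Ycvg] pPsi.
(* The squared distance by Pythagoras, in terms of a norm and coordinates that are visibly
   measurable. *)
pose z w := `|Y w| ^+ 2 - sumsq r (fun h => ip h (Y w)).
have zE w : z w = `|Y w - proj ip r (Y w)| ^+ 2 by rewrite (proj_dist_sqr ipE orth).
have mz : measurable_fun setT z.
  apply: measurable_funB; last by apply: measurable_sumsq => h; exact: measurable_ip.
  apply: measurable_funX; have := measurable_fun_wrtT mY (@norm_continuous _ H).
  exact.
have z0 w : (0 <= (z w)%:E)%E by rewrite zE lee_fin sqr_ge0.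
have iz : (\int[P]_w (z w)%:E = 0)%E.
  apply/eqP; rewrite eq_le integral_ge0// andbT.
  apply: (cvge_to_ge Ycvg); apply: nearW => A.
  apply: integral_le_pointwise => // w; rewrite zE lee_fin.
  apply: (proj_best ipE orth) => //; rewrite psumE; apply: proj_sum => u.
  by case: ifP => // _; rewrite proj0.
have mEz : measurable_fun setT (EFin \o z) by exact/measurable_EFinP.
have : (\int[P]_w `|(EFin \o z) w| = 0)%E.
  by rewrite -[RHS]iz; apply: eq_integral => w _; rewrite gee0_abs ?z0.
move=> /(ae_eq_integral_abs P measurableT mEz); apply: filterS => w /(_ I) [zw].
have : `|Y w - proj ip r (Y w)| ^+ 2 == 0 by rewrite -zE zw.
by rewrite sqrf_eq0 normr_eq0 subr_eq0 => /eqP.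
Qed.

Lemma stoch_integral_range a b (Phi : Omega -> U -> H) (X : Omega -> H) :
  is_stoch_integral P UU F W a b (fun _ => Phi) X ->
  (forall w u, proj ip r (Phi w u) = Phi w u) ->
  {ae P, forall w, proj ip r (X w) = X w}.
Proof.
move=> [n [p [Psi [Y [[pa pb] pmono PhiPsi YPsi [mX XY]]]]]] pPhi.
have pY k : (k < n)%N -> {ae P, forall w, proj ip r (Y k w) = Y k w}.
  move=> kn; apply: (increment_image_range (YPsi k kn)) => w u.
  have := pmono _ kn; rewrite le_eqVlt => /orP[/eqP pk|pk].
    by rewrite pk subrr scale0r proj0.
  by rewrite -(PhiPsi k (p k.+1))// ?pk ?lexx// projZ pPhi.
apply: filterS2 XY (near_forall_lt (G := almost_everywhere P) pY) => w -> pYw.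
by apply: proj_sum => k; exact: pYw.
Qed.

End stochastic_integral_range.

(** * Almost sure approximation of two integrals at once *)

Section common_subsequence.
Context {R : realType} {U H : completeNormedModType R}.
Context {d : measure_display} {Omega : measurableType d}.
Context (P : probability Omega R) (T : R) (F : R -> set_system Omega).
Context (W : R -> U -> Omega -> R).
Hypothesis hF : usual_filtration P T F.
Hypothesis hW : cylindrical_wiener P T F W.
Context (ipH : {dot H for idfun}) (hH : induces_norm ipH) (UU : set U).

(** A net has to be thinned to a sequence. As [r] is finite, for each [n] some finite set has errors
    at most [2 ^ -(n+1)] in all coordinates of both integrals, and summability of these errors gives
    almost sure convergence. *)
Lemma stoch_integral_approx a b (r : seq H) (Phi1 Phi2 : Omega -> U -> H)
    (X1 X2 : Omega -> H) :
  0 <= a -> a < b -> b <= T -> (forall h, h \in r -> `|h| <= 1) ->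
  (forall h u, measurable_fun setT (fun w => ipH h (Phi1 w u))) ->
  (forall h u, measurable_fun setT (fun w => ipH h (Phi2 w u))) ->
  is_stoch_integral P UU F W a b (fun _ => Phi1) X1 ->
  is_stoch_integral P UU F W a b (fun _ => Phi2) X2 ->
  exists A : nat -> {fset U}, forall h, h \in r ->
    {ae P, forall w, coord_sum W ipH UU h Phi1 a b (A n) w @[n --> \oo]
                       --> ipH h (X1 w)} /\
    {ae P, forall w, coord_sum W ipH UU h Phi2 a b (A n) w @[n --> \oo]
                       --> ipH h (X2 w)}.
Proof.
move=> a0 ab bT r1 m1 m2 I1 I2.
have T0ab : 0 <= a <= T /\ 0 <= b <= T.
  by rewrite a0 (le_trans (ltW ab))// bT (le_trans a0)// ltW.
have mX1 : measurable_wrt measurable X1.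
  by case: I1 => n [p [Psi [Y [_ _ _ _ []]]]].
have mX2 : measurable_wrt measurable X2.
  by case: I2 => n [p [Psi [Y [_ _ _ _ []]]]].
pose Z X Phi h A w := ipH h (X w) - coord_sum W ipH UU h Phi a b A w.
pose Q n k A :=
  (\int[P]_w (Z X1 Phi1 (nth 0%R r k) A w ^+ 2)%:E <= (1 / (2 ^ n.+1)%:R)%:E)%E /\
  (\int[P]_w (Z X2 Phi2 (nth 0%R r k) A w ^+ 2)%:E <= (1 / (2 ^ n.+1)%:R)%:E)%E.
have exA n : exists A : {fset U}, forall k, (k < size r)%N -> Q n k A.
  have e0 : 0 < 1 / (2 ^ n.+1)%:R :> R by rewrite divr_gt0// ltr0n expn_gt0.
  have nearQ k : (k < size r)%N -> \forall A \near summability.totally, Q n k A.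
    move=> kr; have hk := r1 _ (mem_nth 0 kr).
    by apply: filterS2 (stoch_integral_coord hF hW hH a0 ab bT hk (m1 _) I1 e0)
      (stoch_integral_coord hF hW hH a0 ab bT hk (m2 _) I2 e0) => A.
  exact: filter_ex (near_forall_lt nearQ).
have [A AP] := choice exA.
exists A => h hr; have kr : (index h r < size r)%N by rewrite index_mem.
have cvgZ X Phi : measurable_wrt measurable X ->
    (forall u, measurable_fun setT (fun w => ipH h (Phi w u))) ->
    (forall n, (\int[P]_w (Z X Phi h (A n) w ^+ 2)%:E <= (1 / (2 ^ n.+1)%:R)%:E)%E) ->
    {ae P, forall w, coord_sum W ipH UU h Phi a b (A n) w @[n --> \oo]
                       --> ipH h (X w)}.
  move=> mX mPhi Zle; apply: filterS (ae_cvg0_of_sqr _ Zle).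
    move=> w /cvgN; rewrite oppr0 => Zw; apply/subr_cvg0; apply: cvg_trans Zw.
    by apply: near_eq_cvg; apply: nearW => n; rewrite /Z/= opprB.
  move=> n; apply: measurable_funB; first exact: measurable_ip.
  by apply: (measurable_coord_sum hF hW) => //; case: T0ab.
split; [apply: (cvgZ X1 Phi1 mX1 (m1 h))|apply: (cvgZ X2 Phi2 mX2 (m2 h))] => n;
  by have := AP n _ kr; rewrite /Q nth_index// => -[].
Qed.

End common_subsequence.

(** * The operators [A] and [B] in the two bases *)

Section operators.
Context {R : realType} {H : completeNormedModType R}.
Context (ip : {dot H for idfun}) (ipE : induces_norm ip) (E : set H).
Hypothesis Ebasis : orthonormal_basis ip E.
Let orth := Ebasis.1.

Lemma diag_dom_finite (m : H -> R) (r : seq H) (x : H) :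
  (forall h, E h -> h \notin r -> ip h x = 0) -> diag_dom ip E m x.
Proof.
move=> x0; rewrite /diag_dom/=.
have -> : \esum_(h in E) ((`|m h * ip h x| ^+ 2)%:E) =
          \esum_(h in E `&` [set` r]) ((`|m h * ip h x| ^+ 2)%:E).
  rewrite esum_mkcondr; apply: eq_esum => h Eh.
  case: ifPn => // hr; rewrite x0 ?mulr0 ?normr0 ?expr0n//.
  by apply: contra hr => hr; rewrite inE.
have fin : finite_set (E `&` [set` r]) by apply: finite_setIr; exact: finite_seq.
rewrite esum_fset//.
by rewrite (fsbig_finite _ _ fin)/= sumEFin ltry.
Qed.

Lemma basis_proj_finite (I : set H) (x : H) : finite_set I ->
  basis_proj ip I x = proj ip (fset_set I) x.
Proof.
move=> finI; apply: hsum_finite; first exact: fset_uniq.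
  by move=> h; rewrite in_fset_set// inE.
by move=> h Ih; rewrite in_fset_set// => /negP[]; rewrite inE.
Qed.

Lemma basis_proj_basis (J : set H) (u : H) : J `<=` E -> E u ->
  basis_proj ip J u = if u \in J then u else 0.
Proof.
move=> JE Eu; rewrite /basis_proj; case: ifPn => uJ.
  rewrite (@hsum_finite _ _ _ _ _ [:: u])//.
  - by rewrite big_seq1 orth// eqxx scale1r.
  - by move=> h; rewrite inE => /eqP ->; exact: set_mem.
  - move=> h Jh; rewrite inE => hu.
    by rewrite orth ?(negbTE hu) ?scale0r//; exact: JE.
rewrite (@hsum_finite _ _ _ _ _ [::])// ?big_nil// => h Jh _.
rewrite orth//; last exact: JE.
case: eqP => [hu|_]; last by rewrite scale0r.
by rewrite hu in Jh; move/negP: uJ; case; rewrite inE.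
Qed.

Context (v : H -> R) (A : H -> H).
Hypothesis hA : forall x, diag_dom ip E v x -> A x = diag_op ip E v x.

Lemma eigvalE h : E h -> eigval ip A h = v h.
Proof.
move=> Eh; have dom : diag_dom ip E v h.
  apply: (@diag_dom_finite _ [:: h]) => k Ek; rewrite inE => kh.
  by rewrite orth// (negbTE kh).
by rewrite /eigval hA// (ip_diag_op ipE orth)// orth// eqxx mulr1.
Qed.

Lemma semigroup_coord (t : R) (r : seq H) (x h : H) :
  (forall h, E h -> h \notin r -> ip h x = 0) -> E h ->
  ip h (semigroup ip E A t x) = expR (t * v h) * ip h x.
Proof.
move=> x0 Eh; rewrite /semigroup (ip_diag_op ipE orth)// ?eigvalE//.
exact: diag_dom_finite x0.
Qed.

Lemma proj_coord_out (r : seq H) (x h : H) : (forall k, k \in r -> E k) ->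
  E h -> h \notin r -> ip h (proj ip r x) = 0.
Proof.
move=> rE Eh hr; rewrite ip_sumr big_seq big1// => k kr.
rewrite ipZr (orth Eh (rE _ kr)).
by case: eqP => [hk|_]; [case/negP: hr; rewrite hk|rewrite mulr0].
Qed.

Lemma normr_basis_le1 h : E h -> `|h| <= 1.
Proof.
move=> Eh; rewrite -(ler_pXn2r (n:=2))// ?nnegrE// expr1n ipE orth// eqxx.
exact: lexx.
Qed.

Context {U : completeNormedModType R} (UU : set U) (B : U -> H) (beta : R).
Hypothesis beta0 : 0 <= beta.
Hypothesis v_neg : (ereal_sup [set (v h)%:E | h in E] < 0)%E.
Hypothesis hB : hilbert_schmidt UU (interp_dom ip E A beta)
  (interp_norm ip E A beta) B.

Lemma spectral_gap : exists2 m : R, 0 < m & forall h, E h -> m <= - v h.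
Proof.
have : exists2 m : R, 0 < m &
    (ereal_sup [set (v h)%:E | h in E] <= (- m)%:E)%E.
  case: ereal_sup v_neg => [s||]//.
    by rewrite lte_fin => s0; exists (- s); rewrite ?oppr_gt0 ?opprK.
  (* The supremum is [-oo] only for an empty family, where any gap will do. *)
  by exists 1; rewrite ?leNye.
move=> [m m0 le]; exists m => // h Eh; rewrite lerNr -lee_fin.
by apply: le_trans le; apply: ereal_sup_ubound; exists h.
Qed.

(** The spectral gap bounds [m ^ beta] times the norm in H by the norm in H_beta, so [B] is
    Hilbert-Schmidt into H as well. Hence [fine] in [hs_norm] meets a finite number and does not
    return its default. *)
Lemma esum_sqr_lty : (\esum_(u in UU) ((`|B u| ^+ 2)%:E) < +oo)%E.
Proof.
have [m m0 vm] := spectral_gap; have [_ domB _ NB] := hB.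
pose c := m `^ beta; have c0 : 0 < c by exact: powR_gt0.
set S := \esum_(u in UU) _ in NB.
have S0 : (0 <= S)%E by apply: esum_ge0 => u _; rewrite lee_fin sqr_ge0.
have Sfin : S \is a fin_num by rewrite ge0_fin_numE.
have Ble u : `|B u| ^+ 2 <= (c ^+ 2)^-1 * interp_norm ip E A beta (B u) ^+ 2.
  rewrite ler_pdivlMl ?exprn_gt0// -exprMn.
  have : c * `|B u| <= interp_norm ip E A beta (B u).
    apply: (normr_le_diag_op ipE orth); [exact: Ebasis.2|exact: domB|exact: ltW|].
    move=> h Eh; rewrite eigvalE//.
    have mh := vm _ Eh; have vh0 := le_trans (ltW m0) mh.
    by apply: ge0_ler_powR => //; rewrite nnegrE// ltW.
  by move=> le; rewrite ler_pXn2r ?nnegrE ?mulr_ge0// ?(ltW c0)//; apply: normr_ge0.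
apply: (@le_lt_trans _ _ ((c ^+ 2)^-1 * fine S)%:E); last exact: ltry.
apply: ge_ereal_sup => _ [X [finX XU] <-]; rewrite fsbig_finite//= sumEFin lee_fin.
apply: le_trans (ler_sum _ (fun u _ => Ble u)) _.
rewrite -mulr_sumr ler_wpM2l ?invr_ge0 ?sqr_ge0// -lee_fin fineK// -sumEFin.
apply: esum_ge; exists X; first by split.
by rewrite fsbig_finite.
Qed.

Lemma hs_sum_le (r : seq U) : uniq r -> (forall u, u \in r -> UU u) ->
  \sum_(u <- r) `|B u| ^+ 2 <= Num.max (hs_norm UU B) 1 ^+ 2.
Proof.
move=> ur rU; set S := \esum_(u in UU) ((`|B u| ^+ 2)%:E).
have S0 : (0 <= S)%E by apply: esum_ge0 => u _; rewrite lee_fin sqr_ge0.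
have Sfin : S \is a fin_num by rewrite ge0_fin_numE// esum_sqr_lty.
apply: (@le_trans _ _ (hs_norm UU B ^+ 2)); last first.
  by rewrite ler_pXn2r ?nnegrE ?sqrtr_ge0 ?le_max ?lexx ?ler01 ?orbT ?sqrtr_ge0.
rewrite /hs_norm sqr_sqrtr ?fine_ge0// -lee_fin fineK// -sumEFin.
apply: esum_ge; exists [set` r]; first by split => //; exact: finite_seq.
by rewrite -fsbig_seq.
Qed.

End operators.

Lemma measurable_fun_gen_le (R : realType) (Omega : pointedType)
    (G1 G2 : set_system Omega) (f : Omega -> R) : G1 `<=` <<s G2>> ->
  measurable_fun [set: g_sigma_algebraType G1] f ->
  measurable_fun [set: g_sigma_algebraType G2] f.
Proof.
move=> G12 mf _ S mS; have : <<s G1 >> ([set: Omega] `&` f @^-1` S) by exact: mf.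
by apply: smallest_sub => //; exact: smallest_sigma_algebra.
Qed.

(** * One step of the scheme *)

Section scheme_step.
Context {R : realType} {H : completeNormedModType R}.
Context (ipH : {dot H for idfun}) (hH : induces_norm ipH) (HH : set H).
Hypothesis HHbasis : orthonormal_basis ipH HH.
Context {U : completeNormedModType R} (ipU : {dot U for idfun}).
Context (hU : induces_norm ipU) (UU : set U).
Hypothesis UUbasis : orthonormal_basis ipU UU.
Context (v : H -> R) (A : H -> H).
Hypothesis v_neg : (ereal_sup [set (v h)%:E | h in HH] < 0)%E.
Hypothesis hA : forall x, diag_dom ipH HH v x -> A x = diag_op ipH HH v x.
Context (B : U -> H) (beta : R) (beta_ge0 : 0 <= beta).
Hypothesis hB : hilbert_schmidt UU (interp_dom ipH HH A beta)
  (interp_norm ipH HH A beta) B.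
Context (I : set H) (IHH : I `<=` HH) (finI : finite_set I).
Context (J : set U) (JUU : J `<=` UU).

Local Notation r := (enum_fset (fset_set I)).
Local Notation L := (Num.max (hs_norm UU B) 1 ^+ 2).

Lemma mem_fset_set_sub h : h \in r -> HH h.
Proof. by rewrite in_fset_set// => /set_mem /IHH. Qed.

(** The matrix of P_I B \hat P_J; the value 0 outside [UU] matches the indices that [psum] skips. *)
Definition noise_coef (h : H) (u : U) : R :=
  if u \in UU then ipH h (basis_proj ipH I (B (basis_proj ipU J u))) else 0.

(** For fixed [u], Bessel's inequality bounds the sum over [h] by [|B u|^2]; the sum over [u] is
    then a part of the Hilbert-Schmidt norm, uniformly in [I] and [J]. *)
Lemma noise_coef_le (s : seq U) : uniq s ->
  \sum_(h <- r) \sum_(u <- s) noise_coef h u ^+ 2 <= L.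
Proof.
move=> us; have rHH := mem_fset_set_sub; have ur := fset_uniq (fset_set I).
rewrite exchange_big/=.
apply: (@le_trans _ _ (\sum_(u <- [seq u <- s | u \in UU]) `|B u| ^+ 2)); last first.
  apply: (hs_sum_le hH HHbasis hA beta_ge0 v_neg hB).
    by rewrite filter_uniq.
  by move=> u; rewrite mem_filter => /andP[/set_mem].
rewrite big_filter [leRHS]big_mkcond/=; apply: ler_sum => u _.
rewrite /noise_coef; case: ifPn => [uU|_]; last by rewrite big1// => h _; rewrite expr0n.
have Uu : UU u by exact: set_mem.
rewrite (basis_proj_basis UUbasis JUU Uu).
set Bu := B _.
have Ble : `|Bu| <= `|B u|.
  rewrite /Bu; case: ifP => // _.
  have linB : linear B by case: hB.
  have := linB (-1) 0 0; rewrite scaler0 addr0 scaleN1r addNr => ->.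
  by rewrite normr0.
apply: (@le_trans _ _ (sumsq r (ipH^~ Bu))).
  rewrite /sumsq big_seq [leRHS]big_seq; apply: ler_sum => h hr.
  by rewrite basis_proj_finite// /proj (ip_expansion HHbasis.1 (ipH^~ Bu) ur rHH hr).
apply: le_trans (bessel hH HHbasis.1 Bu ur rHH) _.
by rewrite ler_pXn2r ?nnegrE.
Qed.

Context {d : measure_display} {Omega : measurableType d}.
Context (P : probability Omega R) (T : R) (F : R -> set_system Omega).
Context (W : R -> U -> Omega -> R).
Hypothesis hF : usual_filtration P T F.
Hypothesis hW : cylindrical_wiener P T F W.

Lemma null_in_filtration (t : R) (S : set Omega) : 0 <= t <= T ->
  measurable S -> P S = 0%E -> <<s F t>> S.
Proof.
move=> /andP[t0 tT] mS PS0; rewrite (filtration_gen hF) ?t0//.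
by apply: (filtration_le hF (lexx 0) t0 tT); exact: (filtration_null hF).
Qed.

Context (t0 t : R) (t0_ge0 : 0 <= t0) (t0t : t0 < t) (tT : t <= T).
Context (c : Omega -> R) (c01 : forall w, 0 <= c w <= 1).
Hypothesis mc : measurable_fun [set: g_sigma_algebraType (F t0)] c.
Context (x y N D : Omega -> H).
Hypothesis mx : forall h,
  measurable_fun [set: g_sigma_algebraType (F t0)] (fun w => ipH h (x w)).
Hypothesis my : measurable_wrt measurable y.
Hypothesis rx : forall w, proj ipH r (x w) = x w.
Hypothesis ry : forall w, proj ipH r (y w) = y w.
Hypothesis intN : is_stoch_integral P UU F W t0 t
  (fun _ w u => c w *:
     semigroup ipH HH A (t - t0) (basis_proj ipH I (B (basis_proj ipU J u)))) N.
Hypothesis intD : is_stoch_integral P UU F W t0 t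
  (fun _ _ u => basis_proj ipH I (B (basis_proj ipU J u))) D.
Hypothesis yE : {ae P, forall w, y w =
  semigroup ipH HH A (t - t0) (x w) + (1 + `|D w| ^+ 2)^-1 *: N w}.

Let t0T : 0 <= t0 <= T. Proof. by rewrite t0_ge0 (le_trans (ltW t0t)). Qed.
Let t_T : 0 <= t <= T. Proof. by rewrite tT andbT (le_trans t0_ge0)// ltW. Qed.
Let F0M : F t0 `<=` measurable. Proof. exact: (filtration_sub hF). Qed.

Local Notation X := (fun A h w =>
  \sum_(u <- enum_fset A) noise_coef h u * (W t u w - W t0 u w)).
Local Notation ee h := (expR ((t - t0) * v h)).

(* The stochastic integrals N and D share one approximating subsequence, so
   their coordinates are proportional. *)
Lemma scheme_approx : exists An : nat -> {fset U},
  (forall h, h \in r -> {ae P, forall w, X (An n) h w @[n --> \oo] --> ipH h (D w)}) /\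
  (forall h, h \in r -> {ae P, forall w, ipH h (y w) =
     ee h * (ipH h (x w) + c w / (1 + sumsq r (fun k => ipH k (D w))) * ipH h (D w))}).
Proof.
have rHH := mem_fset_set_sub; have ur := fset_uniq (fset_set I).
have mc' := measurable_fun_sub_sigma F0M mc.
have r1 h : h \in r -> `|h| <= 1 by move=> /rHH; exact: normr_basis_le1.
have [|h u|An AnP] := stoch_integral_approx hF hW hH t0_ge0 t0t tT r1 _ _ intN intD.
- by move=> h u; under eq_fun do rewrite ipZr; exact: measurable_funM.
- exact: measurable_cst.
exists An; split=> h hr; have [cN cD] := AnP _ hr.
  by apply: filterS cD => w.
(* The taming factor contains the full norm of [D], which reduces to the coordinates on [I] only if
   [D] lies in P_I(H); a version of the integral does so almost surely. *)
have Dr : {ae P, forall w, proj ipH r (D w) = D w}.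
  apply: (stoch_integral_range hH HHbasis.1 ur rHH intD) => w u.
  rewrite basis_proj_finite// [in RHS]/proj; apply: eq_big_seq => k kr.
  by rewrite (ip_expansion HHbasis.1 _ ur rHH kr).
apply: filterS (filterI yE (filterI Dr (filterI cN cD))).
move=> w [-> [Dw [cNw cDw]]].
have projout z k : proj ipH r z = z -> HH k -> k \notin r -> ipH k z = 0.
  by move=> <- Hk kr; exact: (proj_coord_out HHbasis).
have Nw : ipH h (N w) = c w * ee h * ipH h (D w).
  have cD2 : c w * ee h * X (An n) h w @[n --> \oo] --> c w * ee h * ipH h (D w).
    by apply: cvgM; [exact: cvg_cst|exact: cDw].
  have XN n : c w * ee h * X (An n) h w = coord_sum W ipH UU h (fun w u => c w *:
      semigroup ipH HH A (t - t0) (basis_proj ipH I (B (basis_proj ipU J u))))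
      t0 t (An n) w.
    rewrite /coord_sum mulr_sumr; apply: eq_bigr => u _; rewrite /noise_coef.
    case: ifP => _; last by rewrite !mul0r mulr0.
    rewrite ipZr basis_proj_finite// (@semigroup_coord _ _ _ hH _ HHbasis _ _ hA _ r).
    - by rewrite !mulrA.
    - by move=> k Hk kr; exact: (proj_coord_out HHbasis).
    - exact: rHH.
  move: cNw; under eq_cvg do rewrite -XN.
  move=> cNw; exact: (cvg_unique (@norm_hausdorff _ _) cNw cD2).
rewrite ipDr ipZr Nw (@semigroup_coord _ _ _ hH _ HHbasis _ _ hA _ r); last first.
- exact: rHH.
- by move=> k Hk kr; apply: projout.
rewrite (proj_coord hH HHbasis.1 ur rHH Dw).
by rewrite mulrDr; congr (_ + _); rewrite !mulrA; congr (_ * _); ring.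
Qed.

(** Adaptedness follows from the recursion: the approximations involve [x], [c] and the Wiener
    process up to time [t], and their almost sure limit stays measurable because [F t] contains the
    null events. *)
Lemma scheme_measurable h :
  measurable_fun [set: g_sigma_algebraType (F t)] (fun w => ipH h (y w)).
Proof.
have F0t : F t0 `<=` <<s F t>>.
  rewrite (filtration_gen hF t_T).
  by apply: (filtration_le hF t0_ge0 (ltW t0t) tT).
have [An [AD Ay]] := scheme_approx.
have mX A0 k : measurable_fun [set: g_sigma_algebraType (F t)] (X A0 k).
  apply: measurable_sum => u; apply: measurable_funM => //.
  apply: measurable_funB.
    exact: (measurable_fun_wrt (wiener_adapted hW u t_T)).
  apply: (measurable_fun_gen_le F0t).
  exact: (measurable_fun_wrt (wiener_adapted hW u t0T)).
have mk k : k \in r ->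
    measurable_fun [set: g_sigma_algebraType (F t)] (fun w => ipH k (y w)).
  move=> kr; pose f n w := ee k * (ipH k (x w) +
    c w / (1 + sumsq r ((X (An n))^~ w)) * X (An n) k w).
  apply: (@measurable_fun_ae_cvg _ _ _ P (F t) f).
  - by move=> S mS PS; exact: (null_in_filtration t_T).
  - exact: measurable_ip.
  - move=> n; apply: measurable_funM => //.
    apply: (@measurable_tamed _ H _ (g_sigma_algebraType (F t)) r
      (fun j w => ipH j (x w)) (X (An n)) c) => [j||//].
      exact: (measurable_fun_gen_le F0t).
    exact: (measurable_fun_gen_le F0t).
  - apply: filterS2 (Ay _ kr) (ae_cvg_tamed (fun j w => ipH j (x w)) c AD kr).
    by move=> w -> cv; apply: cvgM; [exact: cvg_cst|exact: cv].
(* As [y] lies in the range of [proj], any coordinate is a combination of those on [r]. *)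
have -> : (fun w => ipH h (y w)) = (fun w => \sum_(k <- r)
    (if k \in r then ipH k (y w) else 0) * ipH h k).
  apply/funext => w; rewrite -{1}ry ip_sumr; apply: eq_big_seq => k kr.
  by rewrite ipZr kr.
apply: measurable_sum => k; apply: measurable_funM => //.
by case: (boolP (k \in r)) => [/mk|_].
Qed.

Lemma scheme_step (rho : R) (K := (t - t0) * L) :
  44 <= rho -> 44 * K <= rho ->
  (\int[P]_w (expR (rho^-1 * `|y w| ^+ 2))%:E <=
   \int[P]_w (expR ((rho - 20 * K)^-1 * `|x w| ^+ 2 + 128 * K))%:E)%E.
Proof.
move=> rho44 rhoK; have rho0 : 0 < rho by rewrite (lt_le_trans _ rho44).
have L0 : 0 < L by rewrite exprn_gt0// lt_max ltr01 orbT.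
have K0 : 0 < K by rewrite mulr_gt0// subr_gt0.
have rHH := mem_fset_set_sub; have ur := fset_uniq (fset_set I).
have [An [AD Ay]] := scheme_approx.
have mc' := measurable_fun_sub_sigma F0M mc.
have mx' h := measurable_fun_sub_sigma F0M (mx h).
have mD h : measurable_fun setT (fun w => ipH h (D w)).
  by apply: measurable_ip => //; case: intD => n [p [Psi [Y [_ _ _ _ []]]]].
pose z h w := ipH h (x w) + c w / (1 + sumsq r (fun k => ipH k (D w))) * ipH h (D w).
have mz h : measurable_fun setT (z h).
  exact: (@measurable_tamed _ H _ _ r (fun h w => ipH h (x w))
    (fun h w => ipH h (D w)) c h).
have yE' w : `|y w| ^+ 2 = sumsq r (fun h => ipH h (y w)).
  exact: (proj_coord hH HHbasis.1 ur rHH).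
have coefN : forall h u, ~ UU u -> noise_coef h u = 0.
  by move=> h u Uu; rewrite /noise_coef memNset.
(* The semigroup is dropped: its factors [ee h] are at most 1 since [v h] is negative. *)
apply: (@le_trans _ _ (\int[P]_w (expR (rho^-1 * sumsq r (z^~ w)))%:E)%E).
  apply: ae_ge0_le_integral => //.
  - under eq_fun do rewrite yE'.
    apply/measurable_EFinP; apply: (@measurable_expR_sumsq _ H _ _ r
      (fun h w => ipH h (y w))) => h.
    exact: measurable_ip.
  - by apply/measurable_EFinP; exact: measurable_expR_sumsq.
  have : {ae P, forall w, forall k, (k < size r)%N ->
      ipH (nth 0 r k) (y w) = ee (nth 0 r k) * z (nth 0 r k) w}.
    apply: (near_forall_lt (G := almost_everywhere P)
      (Q := fun k w => ipH (nth 0 r k) (y w) = ee (nth 0 r k) * z (nth 0 r k) w)).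
    by move=> k kr; exact: (Ay _ (mem_nth 0 kr)).
  apply: filterS => w yz _; rewrite lee_fin ler_expR ler_wpM2l ?invr_ge0 ?(ltW rho0)//.
  rewrite yE' /sumsq big_seq [leRHS]big_seq; apply: ler_sum => h hr.
  have := yz (index h r); rewrite index_mem nth_index// => -> //.
  rewrite exprMn ler_piMl ?sqr_ge0// exprn_ile1 ?expR_ge0//.
  rewrite -expR0 ler_expR; have [m m0 vm] := spectral_gap v_neg.
  have := vm _ (rHH _ hr); have : 0 < t - t0 by rewrite subr_gt0.
  nra.
have epsle : rho^-1 <= 44^-1 by rewrite lef_pV2 ?posrE.
have epsK : rho^-1 * K <= 44^-1 by rewrite ler_pdivrMl// ler_pdivlMr// mulrC.
have step := @tamed_step _ _ _ P H (F t0)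
  (sigma_gen (fun (u : U) w => W t u w - W t0 u w)) r
  (fun h w => ipH h (x w)) c (fun n => X (An n)) (fun h w => ipH h (D w)) rho^-1 K.
apply: (le_trans (step _ _ _ _ _ _ _ _ _ _ _ _ _ _)) => //.
- by rewrite invr_ge0 (ltW rho0).
- exact: (sigma_gen_measurable hF hW t0_ge0 t0t tT).
- exact: (increment_indep hF hW t0_ge0 t0t tT).
- move=> n h; apply: measurable_sum => u; apply: measurable_funM => //.
  exact: increment_measurable_gen.
- move=> n l; apply: (increment_sum_mgf hF hW t0_ge0 t0t tT hU UUbasis.1 coefN) => //.
    exact: fset_uniq.
  exact/noise_coef_le/fset_uniq.
- move=> n; apply: (increment_sum_expR_sumsq hF hW t0_ge0 t0t tT hU UUbasis.1 coefN) => //.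
    exact: fset_uniq.
  exact/noise_coef_le/fset_uniq.
apply: integral_le_pointwise => w; first by rewrite lee_fin expR_ge0.
rewrite lee_fin ler_expR lerD2r (proj_coord hH HHbasis.1 ur rHH (rx w)).
rewrite ler_wpM2r ?sumsq_ge0//.
have rK : 0 < rho - 20 * K by rewrite subr_gt0; nra.
rewrite -[leRHS]mul1r ler_pdivlMr//.
have -> : (rho^-1 + 20 * K * rho^-1 ^+ 2) * (rho - 20 * K) = 1 - (20 * K / rho) ^+ 2.
  by field; rewrite gt_eqF.
by rewrite gerBl sqr_ge0.
Qed.

End scheme_step.

(** * Finite time grids *)

Section grids.
Context {R : realType}.

(** Induction on the rank of [t], the number of entries of [s] below it; the grid is a bare finite
    set, and this avoids sorting it. *)
Lemma finite_lt_ind (s : seq R) (Q : R -> Prop) :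
  (forall t, t \in s -> (forall t', t' \in s -> t' < t -> Q t') -> Q t) ->
  forall t, t \in s -> Q t.
Proof.
move=> step t; have [n] := ubnP (count (fun y => y < t) s).
elim: n t => // n IHn t; rewrite ltnS => tn ts.
apply: step => // t' t's t't; apply: IHn => //.
apply: leq_trans tn.
have /permP p := perm_to_rem t's.
rewrite !p /= ltxx t't add0n add1n ltnS.
by apply: sub_count => y /= /lt_trans; apply.
Qed.

Lemma finite_max (s : seq R) (x : R) : x \in s ->
  exists2 m, m \in s & forall y, y \in s -> y <= m.
Proof.
elim: s x => // a [|b s] IHs x _.
  by exists a; rewrite ?mem_head// => y; rewrite inE => /eqP ->.
have [m ms mP] := IHs b (mem_head _ _).
exists (Num.max a m).
  by case: (leP a m) => _; rewrite inE ?eqxx// ms orbT.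
move=> y; rewrite inE le_max => /orP[/eqP ->|/mP ->]; first by rewrite lexx.
by rewrite orbT.
Qed.

Lemma grid_floorP (T t : R) (theta : set R) : grid T theta -> 0 < t ->
  [/\ theta (grid_floor theta t), 0 <= grid_floor theta t &
      grid_floor theta t < t].
Proof.
move=> [/finite_seqP[s ->] _ s0 _] t0; rewrite /grid_floor t0.
set S := _ `&` _.
have S0 : S 0 by split => //=; rewrite in_itv/= lexx.
have SE y : S y <-> y \in [seq y <- s | 0 <= y < t].
  rewrite mem_filter /S/= in_itv/=.
  by split=> [[-> ->]|/andP[]].
have [m /SE mS mP] := finite_max ((SE 0).1 S0).
have ubm : ubound S m by move=> y /SE; exact: mP.
have -> : sup S = m.
  apply/eqP; rewrite eq_le ge_sup//=; last by exists 0.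
  by apply: ub_le_sup => //; exists m.
by case: mS => /= /[!in_itv]/= /andP[-> ->] ?.
Qed.

End grids.

(** * Induction along the grid *)

Section scheme_bound.
Context {R : realType} {H : completeNormedModType R}.
Context (ipH : {dot H for idfun}) (hH : induces_norm ipH) (HH : set H).
Hypothesis HHbasis : orthonormal_basis ipH HH.
Context {U : completeNormedModType R} (ipU : {dot U for idfun}).
Context (hU : induces_norm ipU) (UU : set U).
Hypothesis UUbasis : orthonormal_basis ipU UU.
Context (v : H -> R) (A : H -> H).
Hypothesis v_neg : (ereal_sup [set (v h)%:E | h in HH] < 0)%E.
Hypothesis hA : forall x, diag_dom ipH HH v x -> A x = diag_op ipH HH v x.
Context (B : U -> H) (beta : R) (beta_ge0 : 0 <= beta).
Hypothesis hB : hilbert_schmidt UU (interp_dom ipH HH A beta)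
  (interp_norm ipH HH A beta) B.
Context (I : set H) (IHH : I `<=` HH) (finI : finite_set I).
Context (J : set U) (JUU : J `<=` UU).
Context {d : measure_display} {Omega : measurableType d}.
Context (P : probability Omega R) (T : R) (F : R -> set_system Omega).
Context (W : R -> U -> Omega -> R).
Hypothesis hF : usual_filtration P T F.
Hypothesis hW : cylindrical_wiener P T F W.
Context (theta : set R) (gridT : grid T theta).
Context (chi : R -> Omega -> R) (O : R -> Omega -> H).
Hypothesis chi_01 : forall t w, 0 <= t <= T -> 0 <= chi t w <= 1.
Hypothesis chi_adapted : forall t, 0 <= t <= T -> measurable_wrt (F t) (chi t).
Hypothesis O_meas : forall t, 0 <= t <= T -> measurable_wrt measurable (O t).
Hypothesis O_range : forall t w, 0 <= t <= T -> range (basis_proj ipH I) (O t w).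
Hypothesis O_0 : forall w, O 0 w = 0.
Hypothesis O_rec : forall t, 0 <= t <= T ->
  let t0 := grid_floor theta t in
  exists N D : Omega -> H,
  [/\ is_stoch_integral P UU F W t0 t
        (fun _ w u => chi t0 w *:
           semigroup ipH HH A (t - t0) (basis_proj ipH I (B (basis_proj ipU J u)))) N,
      is_stoch_integral P UU F W t0 t
        (fun _ _ u => basis_proj ipH I (B (basis_proj ipU J u))) D &
      {ae P, forall w, O t w = semigroup ipH HH A (t - t0) (O t0 w) +
         (1 + `|D w| ^+ 2)^-1 *: N w}].

Local Notation L := (Num.max (hs_norm UU B) 1 ^+ 2).
Local Notation M := (Num.max T 1).

(** The first half feeds the independence argument of the next step. A step trades [rho] for
    [rho - 20 * K], so the threshold in the second half grows by [20 * L] per unit of time; its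
    constant part [44 * (L * M)] dominates both 44 and [44 * K] in every step. *)
Let moment_bound (t : R) : Prop :=
  (forall h, measurable_fun [set: g_sigma_algebraType (F t)]
     (fun w => ipH h (O t w))) /\
  (forall rho, 44 * (L * M) + 20 * L * t <= rho ->
     (\int[P]_w (expR (rho^-1 * `|O t w| ^+ 2))%:E <= (expR (128 * L * t))%:E)%E).

Let L1 : 1 <= L. Proof. by rewrite exprn_ege1// le_max lexx orbT. Qed.
Let M1 : 1 <= M. Proof. by rewrite le_max lexx orbT. Qed.
Let LM1 : 1 <= L * M. Proof. by rewrite mulr_ege1. Qed.

Lemma proj_scheme t w : 0 <= t <= T -> proj ipH (fset_set I) (O t w) = O t w.
Proof.
move=> t0T; have [z _ <-] := O_range w t0T.
rewrite basis_proj_finite// [in RHS]/proj; apply: eq_big_seq => k kI.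
rewrite (ip_expansion HHbasis.1 _ (fset_uniq _) _ kI)// => h.
by rewrite in_fset_set// => /set_mem /IHH.
Qed.

Lemma moment_bound0 : moment_bound 0.
Proof.
split=> [h|rho _].
  by under eq_fun do rewrite O_0; exact: measurable_cst.
under eq_integral do rewrite O_0 normr0 expr0n/= mulr0 expR0.
by rewrite integral_cst//= probability_setT mule1 mulr0 expR0.
Qed.

Lemma moment_bound_step t : 0 < t -> t <= T -> moment_bound (grid_floor theta t) -> moment_bound t.
Proof.
move=> t0 tT [mO0 bound0].
have [_ s0 st] := grid_floorP gridT t0.
set s := grid_floor theta t in mO0 bound0 s0 st.
have s0T : 0 <= s <= T by rewrite s0 (le_trans (ltW st)).
have t0T : 0 <= t <= T by rewrite tT ltW.
have [N [D [intN intD OE]]] := O_rec t0T.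
have mchi : measurable_fun [set: g_sigma_algebraType (F s)] (chi s).
  exact: (measurable_fun_wrt (chi_adapted s0T)).
split.
  apply: (scheme_measurable hH HHbasis hA IHH finI hF hW s0 st tT mchi mO0
    (O_meas t0T) _ _ intN intD OE) => w; exact: proj_scheme.
move=> rho rhoP.
pose K := (t - s) * L.
have KLM : K <= L * M.
  rewrite /K mulrC ler_wpM2l ?(le_trans ler01 L1)// le_max.
  by rewrite (le_trans _ tT)// gerBl.
have Ls0 : 0 <= L * s by rewrite mulr_ge0// (le_trans ler01 L1).
have Lt0 : 0 <= L * t by rewrite mulr_ge0 ?(ltW t0)// (le_trans ler01 L1).
have r44 : 44 <= rho by apply: le_trans rhoP; move: LM1 Lt0; lra.
have rK : 44 * K <= rho by apply: le_trans rhoP; move: LM1 Lt0 KLM; lra.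
apply: (@le_trans _ _ _ _ _ (scheme_step hH HHbasis hU UUbasis v_neg hA beta_ge0 hB
  IHH finI JUU hF hW s0 st tT (fun w => chi_01 w s0T) mchi mO0
  (O_meas t0T) (fun w => proj_scheme w s0T) (fun w => proj_scheme w t0T)
  intN intD OE r44 rK)).
rewrite -/K.
under eq_integral do rewrite expRD mulrC EFinM.
rewrite ge0_integralZl//; last first.
  apply/measurable_EFinP; apply: measurableT_comp => //.
  apply: measurable_funM => //; apply: measurable_funX.
  have := measurable_fun_wrtT (O_meas s0T) (@norm_continuous _ H).
  exact.
apply: (@le_trans _ _ ((expR (128 * K))%:E * (expR (128 * L * s))%:E)%E).
  apply: lee_wpmul2l; first by rewrite lee_fin expR_ge0.
  (* The threshold at [s] plus [20 * K] is exactly the threshold at [t]. *)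
  apply: bound0; rewrite lerBrDr; apply: le_trans rhoP.
  by rewrite /K le_eqVlt; apply/orP; left; apply/eqP; ring.
rewrite -EFinM -expRD lee_fin ler_expR /K le_eqVlt; apply/orP; left.
by apply/eqP; ring.
Qed.

(** Rank induction reaches all grid points, each from the grid point before it; an arbitrary time is
    one further step away from a grid point. *)
Lemma scheme_bound t : 0 <= t <= T -> moment_bound t.
Proof.
have [/finite_seqP[s sE] _ theta0 _] := gridT.
have sT q : q \in s -> 0 <= q <= T.
  by have [_ /(_ q) + _ _] := gridT; rewrite sE /= in_itv/=; apply.
have bound_grid : forall q, q \in s -> moment_bound q.
  apply: finite_lt_ind => q qs IHq; have /andP[] := sT q qs.
  rewrite (le_eqVlt 0) => /orP[/eqP <- _|q0 qT]; first exact: moment_bound0.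
  apply: moment_bound_step => //; have [gq g0 gt] := grid_floorP gridT q0.
  by apply: IHq => //; move: gq; rewrite {1}sE.
move=> /andP[]; rewrite (le_eqVlt 0) => /orP[/eqP <- _|t0 tT]; first exact: moment_bound0.
apply: moment_bound_step => //; have [gt g0 lt] := grid_floorP gridT t0.
by apply: bound_grid; move: gt; rewrite {1}sE.
Qed.

End scheme_bound.

Theorem corollary3p4 (R : realType)
  (H : completeNormedModType R) (ipH : {dot H for idfun})
  (hH : induces_norm ipH) (sepH : separable H)
  (U : completeNormedModType R) (ipU : {dot U for idfun})
  (hU : induces_norm ipU) (sepU : separable U)
  (HH : set H) (HH0 : HH !=set0) (HHbasis : orthonormal_basis ipH HH)
  (v : H -> R) (v_neg : (ereal_sup [set (v h)%:E | h in HH] < 0)%E)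
  (DA : set H) (A : H -> H) (hDA : DA = diag_dom ipH HH v)
  (hA : forall x, DA x -> A x = diag_op ipH HH v x)
  (beta T : R) (beta_ge0 : 0 <= beta) (T_gt0 : 0 < T)
  (d : measure_display) (Omega : measurableType d) (P : probability Omega R)
  (F : R -> set_system Omega) (hF : usual_filtration P T F)
  (W : R -> U -> Omega -> R) (hW : cylindrical_wiener P T F W)
  (UU : set U) (UUbasis : orthonormal_basis ipU UU)
  (B : U -> H)
  (hB : hilbert_schmidt UU (interp_dom ipH HH A beta)
          (interp_norm ipH HH A beta) B)
  (chi : set R -> set H -> set U -> R -> Omega -> R)
  (chi_01 : forall theta I J (t : R) w, grid T theta -> I `<=` HH -> finite_set I ->
     J `<=` UU -> 0 <= t <= T -> 0 <= chi theta I J t w <= 1)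
  (chi_adapted : forall theta I J (t : R), grid T theta -> I `<=` HH ->
     finite_set I -> J `<=` UU -> 0 <= t <= T ->
     measurable_wrt (F t) (chi theta I J t))
  (O : set R -> set H -> set U -> R -> Omega -> H)
  (O_meas : forall theta I J (t : R), grid T theta -> I `<=` HH -> finite_set I ->
     J `<=` UU -> 0 <= t <= T -> measurable_wrt measurable (O theta I J t))
  (O_range : forall theta I J (t : R) w, grid T theta -> I `<=` HH ->
     finite_set I -> J `<=` UU -> 0 <= t <= T ->
     range (basis_proj ipH I) (O theta I J t w))
  (O_0 : forall theta I J w, grid T theta -> I `<=` HH -> finite_set I ->
     J `<=` UU -> O theta I J 0 w = 0)
  (O_rec : forall theta I J (t : R), grid T theta -> I `<=` HH -> finite_set I ->
     J `<=` UU -> 0 <= t <= T ->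
     let t0 := grid_floor theta t in
     exists N D : Omega -> H,
     [/\ is_stoch_integral P UU F W t0 t
           (fun _ w u => chi theta I J t0 w *:
              semigroup ipH HH A (t - t0) (basis_proj ipH I (B (basis_proj ipU J u)))) N,
         is_stoch_integral P UU F W t0 t
           (fun _ _ u => basis_proj ipH I (B (basis_proj ipU J u))) D &
         {ae P, forall w, O theta I J t w =
            semigroup ipH HH A (t - t0) (O theta I J t0 w) +
            (1 + `|D w| ^+ 2)^-1 *: N w}])
  (eps : R) (eps_ge0 : 0 <= eps)
  (eps_lt : eps <
     1 / (8 * (Num.max (hs_norm UU B) 1) ^+ 2 * Num.max T 1) ^+ 2) :
  (ereal_sup [set
     ereal_sup [set
       ereal_sup [set
         ereal_sup [set
           'E_P[fun w => expR (eps * `|O theta I J s w| ^+ 2)]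
         | s in `[0%R, T]%classic]
       | I in [set I : set H | I `<=` HH /\ finite_set I]]
     | J in [set J : set U | J `<=` UU]]
   | theta in grid T] < +oo)%E.
Proof.
have hA' x : diag_dom ipH HH v x -> A x = diag_op ipH HH v x.
  by rewrite -hDA; exact: hA.
set L := Num.max (hs_norm UU B) 1 ^+ 2.
set M := Num.max T 1 in eps_lt.
have L1 : 1 <= L by rewrite exprn_ege1// le_max lexx orbT.
have M1 : 1 <= M by rewrite le_max lexx orbT.
have LM1 : 1 <= L * M by rewrite mulr_ege1.
have TM : T <= M by rewrite le_max lexx.
apply: (@le_lt_trans _ _ (expR (128 * L * T))%:E); last exact: ltry.
apply: ge_ereal_sup => _ [theta gridT <-].
apply: ge_ereal_sup => _ [J JUU <-].
apply: ge_ereal_sup => _ [I [IHH finI] <-].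
apply: ge_ereal_sup => _ [s sT <-].
have s0T : 0 <= s <= T by move: sT; rewrite /= in_itv.
have [_ bound] := scheme_bound hH HHbasis hU UUbasis v_neg hA' beta_ge0 hB IHH finI
  JUU hF hW gridT
  (fun t w => chi_01 theta I J t w gridT IHH finI JUU)
  (fun t => chi_adapted theta I J t gridT IHH finI JUU)
  (fun t => O_meas theta I J t gridT IHH finI JUU)
  (fun t w => O_range theta I J t w gridT IHH finI JUU)
  (fun w => O_0 theta I J w gridT IHH finI JUU)
  (fun t => O_rec theta I J t gridT IHH finI JUU) s0T.
have /andP[s0 sT'] := s0T.
have LsT : L * s <= L * T by rewrite ler_wpM2l// (le_trans ler01 L1).
have LTM : L * T <= L * M by rewrite ler_wpM2l// (le_trans ler01 L1).
(* As [64 = 44 + 20] and [s <= T <= M], the value [64 * (L * M)] is above the threshold. Its inverse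
   dominates [eps], because [(8 * L * M) ^+ 2 = 64 * (L * M) ^+ 2] and [1 <= L * M]. *)
rewrite unlock; apply: (le_trans _ (le_trans (bound (64 * (L * M)) _) _)).
- apply: integral_le_pointwise => w; first by rewrite lee_fin expR_ge0.
  rewrite lee_fin ler_expR ler_wpM2r ?sqr_ge0//.
  apply: (le_trans (ltW eps_lt)); rewrite div1r lef_pV2 ?posrE.
  + rewrite -/L (_ : (8 * L * M) ^+ 2 = 64 * ((L * M) * (L * M))); last by ring.
    by move: LM1; nra.
  + rewrite -/L exprn_gt0// mulr_gt0 ?(lt_le_trans ltr01 M1)//.
    by rewrite mulr_gt0// (lt_le_trans ltr01 L1).
  + by rewrite -/L mulr_gt0// (lt_le_trans ltr01 LM1).
- by rewrite -/L -/M; lra.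
- by rewrite lee_fin ler_expR -/L; lra.
Qed.
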